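(* Let $N\ge1$ and $l_1,\dots,l_{2N}>0$, and let $f(z)=m_{12}(z)$, $z>0$, be the term on the first line and second column of the $2\times2$ matrix $M(z)$, so that the characteristic equation is $f(z)=0$: the number $\lambda=iz^2$ ($z>0$) is an eigenvalue of the conservative operator $\mathcal{A}_c$ if and only if $f(z)=0$. Then $$f(z)=z\left(f_\infty(z)+g(z)\right),$$ where $$f_\infty(z)=s_1(z)\cdot c_2(z)\cdot s_3(z)\cdots s_{2N-1}(z)\cdot\big(c_{2N}(z)-s_{2N}(z)\big)$$ and $g$ satisfies $\lim_{z\to+\infty}g(z)=0$. Thus, the asymptotic behavior of the spectrum $\sigma(\mathcal{A}_c)$ corresponds to the roots of the asymptotic characteristic equation $$f_\infty(z)=0.$$
   Context: Let $N\in\mathbb{N}^*$ and $l_1,\dots,l_{2N}>0$; odd indices correspond to strings and even indices to Euler-Bernoulli beams, connected in a chain. Matrices. For $z>0$ and $j=1,\dots,N$ put $c_{2j-1}(z)=\cos(l_{2j-1}z^2)$, $s_{2j-1}(z)=\sin(l_{2j-1}z^2)$, $c_{2j}(z)=\cos(l_{2j}z)$, $s_{2j}(z)=\sin(l_{2j}z)$, $$A_{2j-1}=\begin{pmatrix}c_{2j-1}&s_{2j-1}\\ -s_{2j-1}&c_{2j-1}\end{pmatrix},\qquad T=\begin{pmatrix}1&0\\ 0&-\frac1z\end{pmatrix},$$ $$A_{2j}=\frac{1}{e^{2l_{2j}z}-2e^{l_{2j}z}s_{2j}-1}\begin{pmatrix}e^{2l_{2j}z}(c_{2j}-s_{2j})-c_{2j}-s_{2j}&2s_{2j}(1-e^{2l_{2j}z})\\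 e^{2l_{2j}z}c_{2j}-2e^{l_{2j}z}+c_{2j}&e^{2l_{2j}z}(c_{2j}-s_{2j})-c_{2j}-s_{2j}\end{pmatrix},$$ and $$M(z)=A_{2N}\,T\,A_{2N-1}\cdots T^{-1}A_2\,T\,A_1$$ (edges taken in decreasing order, with $T$ between $A_{2j}$ and $A_{2j-1}$ and $T^{-1}$ between $A_{2j+1}$ and $A_{2j}$). In $f_\infty$, the product contains $s_{2j-1}$ for $j=1,\dots,N$, $c_{2j}$ for $j=1,\dots,N-1$, and the last factor $c_{2N}-s_{2N}$. Operator. $V$ is the space of $\underline{\Phi}=(\Phi_1,\dots,\Phi_{2N})\in\prod_{j=1}^N\big(H^1(0,l_{2j-1})\times H^2(0,l_{2j})\big)$ with $\Phi_j(l_j)=\Phi_{j+1}(0)$ for $1\le j\le 2N-1$, $\Phi_1(0)=0$, $\Phi_{2N}(l_{2N})=0$. Let $X=V\times\prod_{j=1}^{2N}L^2(0,l_j)$. Let $Y_c$ be the set of $(\underline{\Phi},\underline{\Psi})\in V\times V$ with $\Phi_{2j-1}\in H^2(0,l_{2j-1})$, $\Phi_{2j}\in H^4(0,l_{2j})$ and $\partial_x^2\Phi_{2j}(0)=\partial_x^2\Phi_{2j}(l_{2j})=0$ for $j=1,\dots,N$, $\partial_x^3\Phi_{2j}(0)+\partial_x\Phi_{2j-1}(l_{2j-1})=0$ for $j=1,\dots,N$, and $\partial_x^3\Phi_{2j}(l_{2j})+\partial_x\Phi_{2j+1}(0)=0$ for $j=1,\dots,N-1$. On $Y_c$ define $\mathcal{A}_c(\underline{\Phi},\underline{\Psi})=\big(\underline{\Psi},(\partial_x^2\Phi_{2j-1},-\partial_x^4\Phi_{2j})_{1\le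 j\le N}\big)\in X$. Let $P_{0,c}=\frac{1}{2\pi i}\oint_\gamma(\lambda I-\mathcal{A}_c)^{-1}d\lambda$ be the projection of $X$ onto the eigenspace $E_0$ of $\mathcal{A}_c$ for the eigenvalue $0$, where $\gamma$ is a simple closed curve enclosing only the eigenvalue $0$, and set $\mathcal{H}_c=(I-P_{0,c})X$, so that $X=E_0\oplus\mathcal{H}_c$. From then on $\mathcal{A}_c$ denotes the restriction $\mathcal{A}_c:\mathcal{D}(\mathcal{A}_c)=\mathcal{H}_c\cap Y_c\to\mathcal{H}_c$.
   Formalization: The printed factor z in f = z(f_∞+g) is false (for N=1, f is bounded and f/z→0 while f_∞ does not) and is replaced by (−z)^{N−1}; the closing sentence is read as: iz² is an eigenvalue iff f_∞+g=0, and f_∞(z)→0 along such z. *)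

(* Defs.v *)
From HB Require Import structures.
From mathcomp Require Import all_boot all_order all_algebra.
From mathcomp Require Import all_classical all_reals all_analysis.
From mathcomp Require Import complex.

Set Implicit Arguments.
Unset Strict Implicit.
Unset Printing Implicit Defensive.

Import Order.TTheory GRing.Theory Num.Theory.
Import numFieldNormedType.Exports.

Local Open Scope classical_set_scope.
Local Open Scope ring_scope.

(* Edges are numbered 1, ..., 2N as usual; a family indexed by the edges is a
   function on nat of which only the values at 1, ..., 2N are ever used.  Odd
   edges are strings, even edges are beams. *)

Section Matrices.
Variable R : realType.
Variable l : nat -> R.
Implicit Types (z : R) (j n N : nat).

Definition mx2 (a b c d : R) : 'M[R]_2 :=
  \matrix_(i, j) if i == 0 then (if j == 0 then a else b)
                 else (if j == 0 then c else d).

Definition phase j z : R := if odd j then l j * z ^+ 2 else l j * z.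
Definition cs j z : R := cos (phase j z).
Definition sn j z : R := sin (phase j z).

Definition string_mx j z : 'M[R]_2 :=
  mx2 (cs j z) (sn j z) (- sn j z) (cs j z).

Definition beam_mx j z : 'M[R]_2 :=
  let E := expR (l j * z) in
  let c := cs j z in
  let s := sn j z in
  (E ^+ 2 - 2 * E * s - 1)^-1 *:
    mx2 (E ^+ 2 * (c - s) - c - s) (2 * s * (1 - E ^+ 2))
        (E ^+ 2 * c - 2 * E + c)   (E ^+ 2 * (c - s) - c - s).

Definition T_mx z : 'M[R]_2 := mx2 1 0 0 (- z^-1).

(* M(z) for the chain of n string-beam pairs, the empty chain giving 1. *)
Fixpoint transfer n z : 'M[R]_2 :=
  match n with
  | 0 => 1%:M
  | 1 => beam_mx 2 z *m T_mx z *m string_mx 1 z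
  | n'.+1 => beam_mx n.*2 z *m T_mx z *m string_mx n.*2.-1 z
               *m invmx (T_mx z) *m transfer n' z
  end.

Definition charf N z : R := transfer N z 0 1.

Definition charf_infty N z : R :=
  (\prod_(1 <= j < N.+1) sn j.*2.-1 z) * (\prod_(1 <= j < N) cs j.*2 z)
    * (cs N.*2 z - sn N.*2 z).

End Matrices.

Section Sobolev.
Variable R : realType.
Local Notation C := R[i].
Local Notation mu := (@lebesgue_measure R).

Definition normc2 (w : C) : R := complex.Re w ^+ 2 + complex.Im w ^+ 2.

Definition re (u : R -> C) (x : R) : R := complex.Re (u x).
Definition im (u : R -> C) (x : R) : R := complex.Im (u x).

Definition cintegral (D : set R) (u : R -> C) : C :=
  Complex (Rintegral mu D (re u)) (Rintegral mu D (im u)).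

Definition L2 (a : R) (u : R -> C) : Prop :=
  [/\ measurable_fun `[0, a] (re u),
      measurable_fun `[0, a] (im u) &
      mu.-integrable `[0, a] (fun x => (normc2 (u x))%:E)].

(* Square of the L^2(0, a) norm. *)
Definition L2norm2 (a : R) (u : R -> C) : \bar R :=
  (\int[mu]_(x in `[0%R, a]) (normc2 (u x))%:E)%E.

(* An element of H^k(0, a) is handled through its derivatives
   u 0, u 1, ..., u k, i.e. through the isometric embedding of H^k in (L^2)^k.+1.
   For i < k, u i is the absolutely continuous representative on [0, a], so that
   its values at 0 and a are the traces; the entries beyond k are irrelevant. *)
Definition jet : Type := nat -> R -> C.

Definition sobolev (k : nat) (a : R) (u : jet) : Prop :=
  (forall i, (i <= k)%N -> L2 a (u i)) /\
  (forall i, (i < k)%N -> forall x, x \in `[0, a] ->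
     u i x = u i 0 + cintegral `[0, x] (u i.+1)).

End Sobolev.

Section Operator.
Variable R : realType.
Local Notation C := R[i].
Variable N : nat.
Variable l : nat -> R.

(* A state (Phi, Psi); in X only entry 0 of the jets of Psi matters. *)
Definition state : Type := ((nat -> jet R) * (nat -> jet R))%type.
Implicit Types (y x p h : state) (lam nu w : C).

Definition sadd x y : state :=
  (fun j i t => x.1 j i t + y.1 j i t, fun j i t => x.2 j i t + y.2 j i t).
Definition sscale lam y : state :=
  (fun j i t => lam * y.1 j i t, fun j i t => lam * y.2 j i t).
Definition ssub x y : state := sadd x (sscale (-1) y).
Definition szero : state := (fun _ _ _ => 0, fun _ _ _ => 0).

Definition edge j : bool := (1 <= j <= N.*2)%N.

(* H^1 on strings, H^2 on beams. *)
Definition ordV j : nat := if odd j then 1 else 2.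

Definition inV (Phi : nat -> jet R) : Prop :=
  [/\ forall j, edge j -> sobolev (ordV j) (l j) (Phi j),
      forall j, (1 <= j < N.*2)%N -> Phi j 0%N (l j) = Phi j.+1 0%N 0,
      Phi 1%N 0%N 0 = 0 &
      Phi N.*2 0%N (l N.*2) = 0].

Definition inX x : Prop :=
  inV x.1 /\ forall j, edge j -> L2 (l j) (x.2 j 0%N).

(* Square of the Hilbert norm of X. Elements of X are equal when the norm of
   their difference vanishes. *)
Definition normX2 x : \bar R :=
  (\sum_(1 <= j < N.*2.+1)
     (\sum_(0 <= i < (ordV j).+1) L2norm2 (l j) (x.1 j i)
       + L2norm2 (l j) (x.2 j 0%N)))%E.

Definition eqX x y : Prop := normX2 (ssub x y) = 0%E.

Definition inY y : Prop :=
  [/\ inV y.1, inV y.2,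
      forall j, edge j -> sobolev (ordV j).*2 (l j) (y.1 j),
      (forall j, (1 <= j <= N)%N ->
         y.1 j.*2 2%N 0 = 0 /\ y.1 j.*2 2%N (l j.*2) = 0) &
      (forall j, (1 <= j <= N)%N ->
         y.1 j.*2 3%N 0 + y.1 j.*2.-1 1%N (l j.*2.-1) = 0) /\
      (forall j, (1 <= j < N)%N ->
         y.1 j.*2 3%N (l j.*2) + y.1 j.*2.+1 1%N 0 = 0)].

(* (Phi, Psi) |-> (Psi, (d^2 Phi_{2j-1}, - d^4 Phi_{2j})), on the domain inY. *)
Definition Ac y : state :=
  (y.2, fun j i => if odd j then y.1 j i.+2 else fun t => - y.1 j i.+4 t).

(* y = (lam I - Ac)^-1 x *)
Definition resolvent lam x y : Prop :=
  inY y /\ eqX (ssub (sscale lam y) (Ac y)) x.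

(* The a priori bound says both that lam I - Ac is injective and that its
   inverse is bounded. *)
Definition resolvent_set lam : Prop :=
  (forall x, inX x -> exists y, resolvent lam x y) /\
  (exists K : R, forall x y, inX x -> resolvent lam x y ->
     (normX2 y <= K%:E * normX2 x)%E).

(* lam is an eigenvalue of the restriction of Ac to the domain D. *)
Definition eigenvalue_on (D : state -> Prop) lam : Prop :=
  exists y, [/\ D y, ~ eqX y szero & eqX (Ac y) (sscale lam y)].

Section Contour.
(* A closed curve parametrised by [0, 1]. *)
Variable gam : R -> C.

Definition node (n k : nat) : R := k%:R / n%:R.
Definition dgam (n k : nat) : C := gam (node n k.+1) - gam (node n k).

(* Contour integrals are limits of the Riemann-Stieltjes sums over the uniform
   subdivisions of [0, 1]; for a rectifiable curve these sums converge to the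
   integral whenever the integrand is continuous along the curve. *)
Definition csum (F : C -> C) (n : nat) : C :=
  \sum_(0 <= k < n) dgam n k * F (gam (node n k)).

Definition csumX (F : C -> state) (n : nat) : state :=
  \big[sadd/szero]_(0 <= k < n) sscale (dgam n k) (F (gam (node n k))).

Definition two_pi_i : C := Complex 0 (pi *+ 2).

Definition winding nu (w : int) : Prop :=
  (forall t, t \in `[0, 1] -> gam t != nu) /\
  (normc2 (csum (fun lam => (lam - nu)^-1) n - two_pi_i * w%:~R)
     @[n --> \oo] --> (0 : R)).

Definition simple_closed_curve : Prop :=
  [/\ {within `[0, 1], continuous (re gam)} /\
      {within `[0, 1], continuous (im gam)},
      bounded_variation 0 1 (re gam) /\
      bounded_variation 0 1 (im gam),
      gam 0 = gam 1 &
      {in `[0, 1[ &, injective gam}].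

(* gam is positively oriented, runs in the resolvent set and encloses 0 but no
   other eigenvalue of Ac. *)
Definition encloses_only_zero : Prop :=
  [/\ simple_closed_curve,
      forall t, t \in `[0, 1] -> resolvent_set (gam t),
      winding 0 1 &
      forall nu, nu != 0 -> eigenvalue_on inY nu -> winding nu 0].

(* p = P_{0,c} x *)
Definition riesz_projection x p : Prop :=
  inX p /\ exists Rx : C -> state,
    (forall t, t \in `[0, 1] -> resolvent (gam t) x (Rx (gam t))) /\
    (normX2 (ssub (sscale two_pi_i^-1 (csumX Rx n)) p)
       @[n --> \oo] --> (0 : \bar R)%E).

(* The space H_c = (I - P_{0,c}) X. *)
Definition inH h : Prop :=
  inX h /\ exists x p, [/\ inX x, riesz_projection x p & eqX h (ssub x p)].

(* Eigenvalues of the conservative operator, i.e. of Ac with domain the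
   intersection of H_c and Y_c. *)
Definition Ac_eigenvalue lam : Prop :=
  eigenvalue_on (fun y => inH y /\ inY y) lam.

End Contour.

End Operator.

(* Main.v *)
Require Import Defs.
From HB Require Import structures.
From mathcomp Require Import all_boot all_order all_algebra.
From mathcomp Require Import all_classical all_reals all_analysis.
From mathcomp Require Import complex.
From mathcomp Require Import measurable_realfun ring lra.

Set Implicit Arguments.
Unset Strict Implicit.
Unset Printing Implicit Defensive.

Import Order.TTheory GRing.Theory Num.Theory.
Import numFieldNormedType.Exports.

Local Open Scope classical_set_scope.
Local Open Scope ring_scope.

(** With [nu = i z ^+ 2], an eigenvector of [Ac] for [nu] is a pair
    [(Phi, nu * Phi)] where [Phi'' = - z ^+ 4 * Phi] on every string and
    [Phi'''' = z ^+ 4 * Phi] on every beam.  On a string the state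
    [(Phi, Phi' / z ^+ 2)] is rotated by the string matrix.  On a beam whose
    moments [Phi''] vanish at both ends, the state [(Phi, Phi''' / z ^+ 3)] is
    carried from left to right by the beam matrix; its denominator comes from
    the two-point problem and is positive because [sinh t > sin t] for [t > 0]
    ([expR_sin]).  The transmission conditions translate one kind of state into
    the other through [T] or its inverse.  So starting from [Phi = 0] with strain
    [z ^+ 2] there is exactly one motion [wave] along the chain, every other
    motion that vanishes at the left end is a multiple of it ([chained_rigid]),
    and its value at the right end is [charf].  The remaining boundary condition
    therefore has a nonzero solution if and only if [charf] vanishes.

    Weak solutions cause no loss: the jets of a Sobolev eigenfunction are
    successive primitives of each other, hence classical solutions of a linear
    first order system ([sobolev_solves]), for which Gronwall's inequality gives
    uniqueness ([solves_unique]).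

    Restricting [Ac] to the range of [I - P] keeps the eigenvectors for [nu]: on
    such a vector the resolvent is multiplication by [(lam - nu)^-1], whose
    integral along the contour is the winding number around [nu].  That number
    is [0], so [P] kills the vector ([wave_riesz]).

    For the asymptotics, the entries of a beam matrix are within [O(e^(- l z))]
    of the trigonometric matrix with rows [(c - s, - 2 s)] and [(c, c - s)], [T]
    divides the second coordinate by [- z], and its inverse multiplies it by
    [- z].  Measured in powers of [- z], the state at the left end of a string
    is thus concentrated on its second coordinate, which one string-beam pair
    multiplies by [s * c] up to [o(1)] ([asymp_string_in]); the last beam
    contributes [c - s] instead of [c].  The function [g] is the resulting
    [o(1)] term. *)

(** * Two by two matrices acting on columns *)

Section Columns.
Variable R : realType.
Implicit Types (p q z a b c d : R) (n : nat).

Definition col2 p q : 'cV[R]_2 := \col_i (if i == 0 then p else q).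

Lemma mul_mx2_col2 a b c d p q :
  mx2 a b c d *m col2 p q = col2 (a * p + b * q) (c * p + d * q).
Proof.
apply/matrixP => i j; rewrite !mxE !big_ord_recl big_ord0 !mxE /= addr0.
by case: eqP.
Qed.

Lemma scale_mx2 (k a b c d : R) :
  k *: mx2 a b c d = mx2 (k * a) (k * b) (k * c) (k * d).
Proof. by apply/matrixP => i j; rewrite !mxE; do 2 case: eqP. Qed.

Lemma col2E (w : 'cV[R]_2) : w = col2 (w 0 0) (w 1 0).
Proof.
apply/matrixP => i j; rewrite !mxE ord1.
by case: i => -[|[|//]] hi /=; congr (w _ _); apply/val_inj.
Qed.

Lemma col2_0 p q : col2 p q 0 0 = p. Proof. by rewrite mxE. Qed.
Lemma col2_1 p q : col2 p q 1 0 = q. Proof. by rewrite mxE. Qed.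

Lemma invmx_T z : z != 0 -> invmx (T_mx z) = mx2 1 0 0 (- z).
Proof.
move=> z0.
have TV : T_mx z *m mx2 1 0 0 (- z) = 1%:M.
  apply/matrixP => i j; rewrite !mxE !big_ord_recl big_ord0 !mxE /= addr0.
  case: i => -[|[|//]] hi; case: j => -[|[|//]] hj //=;
    rewrite !(mulr0, mul0r, mulr1, addr0, add0r)//.
  by rewrite mulrNN mulVf.
have [uT _] := mulmx1_unit TV.
by rewrite -[RHS]mul1mx -(mulVmx uT) -mulmxA TV mulmx1.
Qed.

End Columns.

(** * Asymptotic equality at infinity *)

Section Asymptotics.
Variable R : realType.
Implicit Types (u v : R -> R).

(** Boundedness of [v] is part of the relation so that it is compatible with
    products. *)
Definition asymp u v : Prop :=
  (exists M, forall z, `|v z| <= M) /\ u z - v z @[z --> +oo] --> (0 : R).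

Lemma asymp_ext u v u' v' : u =1 u' -> v =1 v' -> asymp u v -> asymp u' v'.
Proof. by move=> /funext-> /funext->. Qed.

Lemma asymp_near u u' v :
  (\forall z \near +oo, u z = u' z) -> asymp u v -> asymp u' v.
Proof.
move=> uu' [bd h]; split=> //; apply: cvg_trans h.
by apply: near_eq_cvg; near=> z; congr (_ - _); near: z; apply: filterS uu' => z ->.
Unshelve. all: by end_near. Qed.

Lemma asymp_refl M u : (forall z, `|u z| <= M) -> asymp u u.
Proof.
by split; [exists M|under eq_fun do rewrite subrr; exact: cvg_cst].
Qed.

Lemma asymp_cst (a : R) : asymp (fun=> a) (fun=> a).
Proof. by apply: (@asymp_refl `|a|). Qed.

Lemma asymp0P u : asymp u (fun=> 0) <-> u z @[z --> +oo] --> (0 : R).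
Proof.
split=> [[_ /subr_cvg0//]|u0]; split; last exact/subr_cvg0.
by exists 0 => z; rewrite normr0.
Qed.

Lemma asympD u v u' v' :
  asymp u v -> asymp u' v' -> asymp (fun z => u z + u' z) (fun z => v z + v' z).
Proof.
move=> [[M vM] h] [[M' vM'] h']; split.
  by exists (M + M') => z; rewrite (le_trans (ler_normD _ _))// lerD.
rewrite -[0]addr0; under eq_fun do rewrite opprD addrACA.
exact: cvgD.
Qed.

Lemma asympN u v : asymp u v -> asymp (fun z => - u z) (fun z => - v z).
Proof.
move=> [[M vM] h]; split; first by exists M => z; rewrite normrN.
by rewrite -oppr0; under eq_fun do rewrite -opprD; exact: cvgN.
Qed.

Lemma cvg0_bounded u v M :
  (forall z, `|v z| <= M) -> u z @[z --> +oo] --> (0 : R) ->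
  u z * v z @[z --> +oo] --> (0 : R).
Proof.
move=> bv u0; apply: norm_cvg0.
have uM0 : `|u z| * M @[z --> +oo] --> (0 : R).
  by rewrite -(mul0r M) -{1}(normr0 R); apply: cvgM; [exact: cvg_norm|exact: cvg_cst].
apply: (@squeeze_cvgr _ _ _ _ (cst 0) (fun z => `|u z| * M)) => //; last exact: cvg_cst.
by near=> z; rewrite normr_ge0 /= normrM ler_wpM2l.
Unshelve. all: by end_near. Qed.

Lemma asympM u v u' v' :
  asymp u v -> asymp u' v' -> asymp (fun z => u z * u' z) (fun z => v z * v' z).
Proof.
move=> [[M vM] h] [[M' vM'] h']; split.
  by exists (M * M') => z; rewrite normrM ler_pM.
have split z : u z * u' z - v z * v' z = (u z - v z) * (u' z - v' z) +
    ((u z - v z) * v' z + (u' z - v' z) * v z) by ring.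
under eq_fun do rewrite split.
rewrite -[0]addr0 -{1}(mulr0 0); apply: cvgD; first exact: cvgM.
by rewrite -[0]addr0; apply: cvgD; [exact: (cvg0_bounded vM' h)|exact: (cvg0_bounded vM h')].
Qed.

(** Asymptotic equality is not closed under inversion in general, as the limit
    function may vanish; the denominators that occur here tend to [1]. *)
Lemma asympV u : asymp u (fun=> 1) -> asymp (fun z => (u z)^-1) (fun=> 1).
Proof.
move=> [bd /subr_cvg0 u1]; split=> //; apply/subr_cvg0.
by rewrite -[1]invr1; apply: cvgV => //; exact: oner_neq0.
Qed.

Lemma asymp_inv : asymp (fun z => z^-1) (fun=> 0).
Proof.
apply/asymp0P; apply/gtr0_cvgV0; last exact: cvg_id.
by near=> z; near: z; exact: nbhs_pinfty_gt.
Unshelve. all: by end_near. Qed.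

Lemma asymp_exp (a : R) : 0 < a -> asymp (fun z => expR (- (a * z))) (fun=> 0).
Proof.
move=> a0; apply/asymp0P.
apply: (@cvg_comp _ _ _ (fun z => a * z) (fun x => expR (- x)) _ (pinfty_nbhs R));
  last exact: cvgr_expR.
by apply: gt0_cvgMry => //; exact: cvg_id.
Qed.

End Asymptotics.

(** * Transfer along the chain and its asymptotics *)

Section Chain.
Variables (R : realType) (l : nat -> R).
Implicit Types (z : R) (n j : nat).

Lemma asymp_cs j : asymp (cs l j) (cs l j).
Proof. by apply: (@asymp_refl _ 1) => z; rewrite ler_norml cos_geN1 cos_le1. Qed.

Lemma asymp_sn j : asymp (sn l j) (sn l j).
Proof. by apply: (@asymp_refl _ 1) => z; rewrite ler_norml sin_geN1 sin_le1. Qed.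

Definition beam_den j z : R :=
  expR (l j * z) ^+ 2 - 2 * expR (l j * z) * sn l j z - 1.

(** Dividing numerator and denominator by [e^(2 l z)] leaves only decaying
    exponentials. *)
Lemma beam_coef j z (x : R) :
  (beam_den j z)^-1 * x = expR (- (l j * z)) ^+ 2 * x *
    (1 - 2 * expR (- (l j * z)) * sn l j z - expR (- (l j * z)) ^+ 2)^-1.
Proof.
rewrite /beam_den expRN; set E := expR _; have E0 : E != 0 by rewrite gt_eqF ?expR_gt0.
rewrite (_ : _ - _ - 1 = E ^+ 2 * (1 - 2 * E^-1 * sn l j z - E^-1 ^+ 2)); last by field.
by rewrite invfM exprVn; ring.
Qed.

Lemma asymp_beam_coef j (x : R -> R) (y : R -> R) : 0 < l j ->
  asymp (fun z => expR (- (l j * z)) ^+ 2 * x z) y ->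
  asymp (fun z => (beam_den j z)^-1 * x z) y.
Proof.
move=> lj0 hx; have he := asymp_exp lj0.
apply: asymp_ext (fun z => esym (beam_coef j z (x z))) (fun z => mulr1 (y z)) _.
apply: asympM => //; apply: asympV.
have hes := asympM (asympM (asymp_cst 2) he) (asymp_sn j).
have := asympD (asympD (asymp_cst 1) (asympN hes)) (asympN (asympM he he)).
apply: asymp_ext => z; first by rewrite expr2.
ring.
Qed.

Lemma asymp_beam11 j : 0 < l j ->
  asymp (fun z => (beam_den j z)^-1 *
           (expR (l j * z) ^+ 2 * (cs l j z - sn l j z) - cs l j z - sn l j z))
        (fun z => cs l j z - sn l j z).
Proof.
move=> lj0; apply: asymp_beam_coef => //; have he := asymp_exp lj0.
have hc := asymp_cs j; have hs := asymp_sn j.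
have := asympD (asympD hc (asympN hs)) (asympN (asympM (asympM he he) (asympD hc hs))).
apply: asymp_ext => z; last ring.
rewrite expRN; field.
by rewrite gt_eqF ?expR_gt0.
Qed.

Lemma asymp_beam12 j : 0 < l j ->
  asymp (fun z => (beam_den j z)^-1 *
           (2 * sn l j z * (1 - expR (l j * z) ^+ 2)))
        (fun z => - (2 * sn l j z)).
Proof.
move=> lj0; apply: asymp_beam_coef => //; have he := asymp_exp lj0.
have h2s := asympM (asymp_cst 2) (asymp_sn j).
have := asympD (asympN h2s) (asympM (asympM he he) h2s).
apply: asymp_ext => z; last ring.
rewrite expRN; field.
by rewrite gt_eqF ?expR_gt0.
Qed.

Lemma asymp_beam21 j : 0 < l j ->
  asymp (fun z => (beam_den j z)^-1 *
           (expR (l j * z) ^+ 2 * cs l j z - 2 * expR (l j * z) + cs l j z))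
        (cs l j).
Proof.
move=> lj0; apply: asymp_beam_coef => //; have he := asymp_exp lj0.
have hc := asymp_cs j.
have := asympD (asympD hc (asympN (asympM (asymp_cst 2) he))) (asympM (asympM he he) hc).
apply: asymp_ext => z; last ring.
rewrite expRN; field.
by rewrite gt_eqF ?expR_gt0.
Qed.

Lemma mul_beam_col2 j z (p q : R) : beam_mx l j z *m col2 p q =
  col2 ((beam_den j z)^-1 *
           (expR (l j * z) ^+ 2 * (cs l j z - sn l j z) - cs l j z - sn l j z) * p +
        (beam_den j z)^-1 * (2 * sn l j z * (1 - expR (l j * z) ^+ 2)) * q)
       ((beam_den j z)^-1 *
           (expR (l j * z) ^+ 2 * cs l j z - 2 * expR (l j * z) + cs l j z) * p +
        (beam_den j z)^-1 *
           (expR (l j * z) ^+ 2 * (cs l j z - sn l j z) - cs l j z - sn l j z) * q).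
Proof. by rewrite /beam_mx scale_mx2 mul_mx2_col2. Qed.

(** The state [(Phi, Phi' / z ^+ 2)] at the left end of string [2n+1] for the
    motion that starts from [(0, 1)]. *)
Fixpoint string_in n z : 'cV[R]_2 :=
  match n with
  | 0 => col2 0 1
  | n'.+1 => invmx (T_mx z) *m (beam_mx l n.*2 z *m (T_mx z *m
               (string_mx l n.*2.-1 z *m string_in n' z)))
  end.

(** The states [(Phi, Phi''' / z ^+ 3)] at the two ends of beam [2n+2]. *)
Definition beam_in n z : 'cV[R]_2 :=
  T_mx z *m (string_mx l n.*2.+1 z *m string_in n z).

Definition beam_out n z : 'cV[R]_2 := beam_mx l n.*2.+2 z *m beam_in n z.

Lemma string_inS n z : string_in n.+1 z = invmx (T_mx z) *m beam_out n z.
Proof. by []. Qed.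

Lemma transfer_beam_out n z : transfer l n.+1 z *m col2 0 1 = beam_out n z.
Proof.
elim: n => [|n IH]; first by rewrite /= -!mulmxA.
by rewrite /beam_out /beam_in string_inS -IH !mulmxA.
Qed.

Lemma charf_beam_out n z : charf l n.+1 z = beam_out n z 0 0.
Proof.
rewrite -transfer_beam_out /charf mxE !big_ord_recl big_ord0 !mxE /=.
rewrite mulr0 add0r mulr1 addr0 (_ : lift 0 0 = 1) //; exact/val_inj.
Qed.

(** The second coordinate of [string_in n], divided by [(- z) ^+ n], is asymptotic
    to this product. *)
Definition amplitude n z : R := \prod_(1 <= j < n.+1) (sn l j.*2.-1 z * cs l j.*2 z).

Lemma amplitudeS n z :
  amplitude n.+1 z = amplitude n z * (sn l n.*2.+1 z * cs l n.*2.+2 z).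
Proof. by rewrite /amplitude big_nat_recr. Qed.

Lemma charf_infty_amplitude n z :
  charf_infty l n.+1 z = amplitude n z * sn l n.*2.+1 z * (cs l n.*2.+2 z - sn l n.*2.+2 z).
Proof.
rewrite /charf_infty /amplitude big_nat_recr //= big_split /=.
by rewrite -!mulrA; congr (_ * _); rewrite [in RHS]mulrCA.
Qed.

Lemma asymp_amplitude n : asymp (amplitude n) (amplitude n).
Proof.
apply: (@asymp_refl _ 1) => z; rewrite /amplitude; apply: (big_ind (fun x : R => `|x| <= 1)).
- by rewrite normr1.
- by move=> x y hx hy; rewrite normrM mulr_ile1.
- by move=> j _; rewrite normrM mulr_ile1 // ler_norml ?cos_geN1 ?cos_le1 ?sin_geN1 ?sin_le1.
Qed.

(** Through [T], only the displacement [s * amplitude] at the end of the string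
    enters the beam at leading order, so that just the first column of the beam
    matrix matters. *)
Lemma asymp_beam_out n : 0 < l n.*2.+2 ->
  asymp (fun z => (- z)^-1 ^+ n * string_in n z 0 0) (fun=> 0) ->
  asymp (fun z => (- z)^-1 ^+ n * string_in n z 1 0) (amplitude n) ->
  asymp (fun z => (- z)^-1 ^+ n * beam_out n z 0 0) (charf_infty l n.+1) /\
  asymp (fun z => (- z)^-1 ^+ n * beam_out n z 1 0) (amplitude n.+1).
Proof.
move=> ln ha hb; have hA := asymp_amplitude n.
have hc := asymp_cs n.*2.+1; have hs := asymp_sn n.*2.+1.
have hu := asympD (asympM hc ha) (asympM hs hb).
have hv := asympM (asympN (asymp_inv R)) (asympD (asympM (asympN hs) ha) (asympM hc hb)).
have h1 := asympD (asympM (asymp_beam11 ln) hu) (asympM (asymp_beam12 ln) hv).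
have h2 := asympD (asympM (asymp_beam21 ln) hu) (asympM (asymp_beam11 ln) hv).
have E z : beam_out n z = _ :=
  congr1 (fun w => beam_mx l n.*2.+2 z *m (T_mx z *m (string_mx l n.*2.+1 z *m w)))
    (col2E (string_in n z)).
split.
- apply: asymp_ext h1 => z; last by rewrite charf_infty_amplitude; ring.
  by rewrite E !mul_mx2_col2 mul_beam_col2 col2_0; ring.
- apply: asymp_ext h2 => z; last first.
    by rewrite amplitudeS; ring.
  by rewrite E !mul_mx2_col2 mul_beam_col2 col2_1; ring.
Qed.

(** Multiplication of the second coordinate by [- z] in the inverse of [T] is
    what makes it dominate the first one. *)
Lemma asymp_string_in n : (forall j, (1 <= j <= n)%N -> 0 < l j.*2) ->
  asymp (fun z => (- z)^-1 ^+ n * string_in n z 0 0) (fun=> 0) /\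
  asymp (fun z => (- z)^-1 ^+ n * string_in n z 1 0) (amplitude n).
Proof.
elim: n => [_|n IH hl].
  split; [apply: asymp_ext (asymp_cst 0)|apply: asymp_ext (asymp_cst 1)] => z //.
  - by rewrite col2_0 mulr0.
  - by rewrite col2_1 mulr1.
  - by rewrite /amplitude big_geq.
have [j /andP[j1 jn]|ha hb] := IH; first by apply: hl; rewrite j1 leqW.
have ln : 0 < l n.*2.+2 by have := hl n.+1; apply; rewrite leqnn.
have [h1 h2] := asymp_beam_out ln ha hb.
have E z : z != 0 -> string_in n.+1 z = col2 (beam_out n z 0 0) (- z * beam_out n z 1 0).
  move=> z0; rewrite string_inS invmx_T// {1}[beam_out n z]col2E mul_mx2_col2.
  by rewrite !mul1r !mul0r addr0 add0r.
split.
- have h : asymp (fun z => - z^-1 * ((- z)^-1 ^+ n * beam_out n z 0 0)) (fun=> 0).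
    by apply: asymp_ext (asympM (asympN (asymp_inv R)) h1) => // z; rewrite oppr0 mul0r.
  apply: asymp_near h; near=> z.
  have z0 : z != 0 by rewrite gt_eqF //; near: z; exact: nbhs_pinfty_gt.
  by rewrite E// col2_0 exprS invrN mulrA.
- apply: asymp_near h2; near=> z.
  have z0 : z != 0 by rewrite gt_eqF //; near: z; exact: nbhs_pinfty_gt.
  by rewrite E// col2_1 exprSr mulrA divfK // oppr_eq0.
Unshelve. all: by end_near. Qed.

Lemma charf_asymp N : (1 <= N)%N -> (forall j, (1 <= j <= N)%N -> 0 < l j.*2) ->
  (- z) ^- N.-1 * charf l N z - charf_infty l N z @[z --> +oo] --> (0 : R).
Proof.
case: N => // n _ hl.
have [j /andP[j1 jn]|ha hb] := @asymp_string_in n; first by apply: hl; rewrite j1 leqW.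
have ln : 0 < l n.*2.+2 by have := hl n.+1; apply; rewrite leqnn.
have [[_ h] _] := asymp_beam_out ln ha hb.
by under eq_fun do rewrite charf_beam_out -exprVn.
Qed.

End Chain.

(** * Uniqueness for linear differential equations *)

Section LinearODE.
Variable R : realType.
Implicit Types (v w : nat -> R -> R) (f g : R -> R) (x y a c k : R) (n i : nat).

Lemma is_derive_eqfun f g x df dg :
  is_derive x 1 f df -> f =1 g -> df = dg -> is_derive x 1 g dg.
Proof. by move=> h /funext <- <-. Qed.

Lemma is_derive_add f g x df dg : is_derive x 1 f df -> is_derive x 1 g dg ->
  is_derive x 1 (fun y => f y + g y) (df + dg).
Proof. by move=> hf hg; exact: (is_deriveD hf hg). Qed.

Lemma is_derive_scale c f x df :
  is_derive x 1 f df -> is_derive x 1 (fun y => c * f y) (c * df).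
Proof. by move=> hf; exact: (is_deriveZ c hf). Qed.

Lemma is_derive_cont f x df : is_derive x 1 f df -> {for x, continuous f}.
Proof. by move=> [h _]; apply/differentiable_continuous/derivable1_diffP. Qed.

Lemma within_continuousM (A : set R) f g : {within A, continuous f} ->
  {within A, continuous g} -> {within A, continuous (fun x => f x * g x)}.
Proof.
move=> /subspace_continuousP cf /subspace_continuousP cg.
by apply/subspace_continuousP => x Ax; apply: cvgM; [exact: cf|exact: cg].
Qed.

Lemma within_continuous_sum n (A : set R) (h : 'I_n -> R -> R) :
  (forall j, {within A, continuous (h j)}) ->
  {within A, continuous (fun x => \sum_(j < n) h j x)}.
Proof.
elim: n h => [h _|n IH h ch].
  by under eq_fun do rewrite big_ord0; apply: continuous_subspaceT => x; exact: cst_continuous.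
under eq_fun do rewrite big_ord_recl.
by apply: within_continuousD => //; apply: IH.
Qed.

(** The equation [v 0 ^(n) = k * v 0] is encoded as a first order system for
    [v 0, ..., v n.-1]: the last derivative is [k * v 0] itself and not [v n],
    which a Sobolev jet controls only almost everywhere. *)
Definition next_jet n k v i : R -> R :=
  if i.+1 == n then fun x => k * v 0%N x else v i.+1.

Definition solves n k a v : Prop :=
  forall i, (i < n)%N -> {within `[0, a], continuous (v i)} /\
    forall x, x \in `]0, a[ -> is_derive x 1 (v i) (next_jet n k v i x).

Lemma solves_lin n k a v w (c : R) : solves n k a v -> solves n k a w ->
  solves n k a (fun i x => v i x + c * w i x).
Proof.
move=> hv hw i ni; have [cv dv] := hv i ni; have [cw dw] := hw i ni; split.
  apply: within_continuousD => //; apply: within_continuousM => //.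
  by apply: continuous_subspaceT => x; exact: cst_continuous.
move=> x xa; have h1 := dv x xa; have h2 := dw x xa.
apply: (is_derive_eqfun (is_derive_add h1 (is_derive_scale c h2)) (frefl _)).
by rewrite /next_jet; case: ifP => _ //; ring.
Qed.

Definition energy n v x : R := \sum_(i < n) v i x ^+ 2.

Lemma energy_ge n v i x : (i < n)%N -> v i x ^+ 2 <= energy n v x.
Proof.
move=> ni; rewrite /energy (bigD1 (Ordinal ni)) //= lerDl sumr_ge0// => j _.
exact: sqr_ge0.
Qed.

(** Gronwall: the derivative of the energy is at most a constant times the
    energy, so that the energy times a decaying exponential is nonincreasing; it
    is nonnegative and starts at [0]. *)
Lemma solves_unique n k a v : solves n k a v -> (forall i, (i < n)%N -> v i 0 = 0) ->
  forall i x, (i < n)%N -> x \in `[0, a] -> v i x = 0.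
Proof.
move=> hv v0 i x ni xa.
(* Each of the [n] terms [2 v_j v_j'] of the derivative is at most
   [v_j ^+ 2 + v_j' ^+ 2], where [v_j ^+ 2 <= energy] and
   [v_j' ^+ 2 <= (1 + k ^+ 2) * energy]. *)
pose K : R := n%:R * (2 + k ^+ 2).
have dE y : y \in `]0, a[ ->
    is_derive y 1 (energy n v) (\sum_(j < n) 2 * v j y * next_jet n k v j y).
  move=> ya.
  have h (j : 'I_n) : is_derive y 1 (fun x => v j x ^+ 2) (2 * v j y * next_jet n k v j y).
    have hj := (hv j (ltn_ord j)).2 y ya.
    by apply: (is_derive_eqfun (f := v j ^+ 2)).
  apply: (is_derive_eqfun (is_derive_sum h)) => // t.
  by rewrite fct_sumE.
have dE_le y : y \in `]0, a[ ->
    \sum_(j < n) 2 * v j y * next_jet n k v j y <= K * energy n v y.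
  move=> ya; have E0 : 0 <= energy n v y by apply: sumr_ge0 => j _; exact: sqr_ge0.
  have -> : K * energy n v y = \sum_(j < n) (2 + k ^+ 2) * energy n v y.
    by rewrite sumr_const card_ord -[RHS]mulr_natl mulrA.
  apply: ler_sum => j _; have hj := energy_ge v y (ltn_ord j).
  have hn : next_jet n k v j y ^+ 2 <= (1 + k ^+ 2) * energy n v y.
    have k0 := sqr_ge0 k.
    rewrite /next_jet; case: eqP => [jn|jn].
      have n0 : (0 < n)%N by rewrite -jn.
      have := energy_ge v y n0; rewrite exprMn => h0; nra.
    have jn' : (j.+1 < n)%N by rewrite ltn_neqAle ltn_ord andbT; apply/eqP.
    have := energy_ge v y jn'; nra.
  have := sqr_ge0 (v j y - next_jet n k v j y); nra.
pose h y := expR (- (K * y)) * energy n v y.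
have dh y : y \in `]0, a[ -> is_derive y 1 h
    (expR (- (K * y)) * (\sum_(j < n) 2 * v j y * next_jet n k v j y - K * energy n v y)).
  move=> ya; have hE := dE y ya.
  have he : is_derive y 1 (fun y => expR (- (K * y))) (- K * expR (- (K * y))).
    have hl : is_derive y 1 (fun y => - (K * y)) (- K).
      apply: (is_derive_eqfun (f := (- K) \*: id)) => [t|]; rewrite /= /GRing.scale /=; ring.
    by rewrite mulrC; exact: (is_derive1_comp _ hl).
  apply: (is_derive_eqfun (f := (fun y => expR (- (K * y))) * energy n v)) => //.
  rewrite /GRing.scale /=; ring.
have ch : {within `[0, a], continuous h}.
  apply: within_continuousM.
    apply: continuous_subspaceT => y; apply: continuous_comp; last exact: continuous_expR.
    by apply: continuousN; apply: continuousM; [exact: cst_continuous|exact: cvg_id].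
  apply: within_continuous_sum => j.
  by apply: (within_continuousM (hv j (ltn_ord j)).1 (hv j (ltn_ord j)).1).
have hx0 : h x <= h 0.
  move: xa; rewrite in_itv/= => /andP[x0 xa].
  have dh1 y : y \in `]0, a[ -> derivable h y 1 by move=> /dh[].
  have dh2 y : y \in `]0, a[ -> derive1 h y <= 0.
    move=> ya; rewrite derive1E; have [_ ->] := dh y ya.
    by rewrite pmulr_rle0 ?expR_gt0 // subr_le0 dE_le.
  apply: (ler0_derive1_le_cc dh1 dh2 ch); last exact: x0.
    by rewrite in_itv /= x0 xa.
  by rewrite in_itv /= lexx (le_trans x0 xa).
have h00 : h 0 = 0.
  by rewrite /h /energy big1 ?mulr0// => j _; rewrite v0// expr0n.
have : expR (- (K * x)) * v i x ^+ 2 <= 0.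
  by rewrite -h00 (le_trans _ hx0)// ler_wpM2l ?expR_ge0// energy_ge.
rewrite pmulr_rle0 ?expR_gt0// => h1.
by apply/eqP; rewrite -sqrf_eq0 eq_le h1 sqr_ge0.
Qed.

End LinearODE.

(** * Explicit motions of a string and of a beam *)

Section Waves.
Variable R : realType.
Implicit Types (v : nat -> R -> R) (x y a k z w p q : R) (n i : nat).

Definition smooth v : Prop := forall i x, is_derive x 1 (v i) (v i.+1 x).

Lemma smooth_solves n k a v :
  smooth v -> (forall x, v n x = k * v 0%N x) -> solves n k a v.
Proof.
move=> sv vn i ni; split.
  by apply: continuous_subspaceT => x; exact: (is_derive_cont (sv i x)).
move=> x _; rewrite /next_jet; case: (i.+1 =P n) => [e|_]; last exact: sv.
by rewrite -vn -e; exact: sv.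
Qed.

Lemma smoothD v v' : smooth v -> smooth v' -> smooth (fun i x => v i x + v' i x).
Proof.
move=> sv sv' i x; have h := sv i x; have h' := sv' i x.
exact: is_derive_add.
Qed.

(** The jet of [p * cos (w x) + q * sin (w x)]. *)
Fixpoint osc w p q i x : R :=
  match i with
  | 0 => p * cos (w * x) + q * sin (w * x)
  | i'.+1 => w * osc w q (- p) i' x
  end.

(** The jet of [p * e^(z x) + q * e^(- z x)]. *)
Definition expo z p q i x : R :=
  p * z ^+ i * expR (z * x) + q * (- z) ^+ i * expR (- z * x).

Lemma is_derive_comp_lin (f : R -> R) w x df :
  is_derive (w * x) 1 f df -> is_derive x 1 (fun x => f (w * x)) (w * df).
Proof.
move=> hf.
have hl : is_derive x 1 (fun x => w * x) w.
  apply: (is_derive_eqfun (f := w \*: id)) => //; rewrite /GRing.scale /=; ring.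
by rewrite mulrC; exact: (is_derive1_comp hf hl).
Qed.

Lemma smooth_osc w p q : smooth (osc w p q).
Proof.
move=> i; elim: i p q => [|i IH] p q x /=.
  have hc := is_derive_comp_lin (is_derive_cos (w * x)).
  have hs := is_derive_comp_lin (is_derive_sin (w * x)).
  have h := is_derive_add (is_derive_scale p hc) (is_derive_scale q hs).
  by apply: (is_derive_eqfun h (frefl _)); ring.
have h := IH q (- p) x.
exact: is_derive_scale.
Qed.

Lemma smooth_expo z p q : smooth (expo z p q).
Proof.
move=> i x; have h1 := is_derive_comp_lin (is_derive_expR (z * x)).
have h2 := is_derive_comp_lin (is_derive_expR (- z * x)).
have h := is_derive_add (is_derive_scale (p * z ^+ i) h1)
  (is_derive_scale (q * (- z) ^+ i) h2).
by apply: (is_derive_eqfun h (frefl _)); rewrite /expo !exprS; ring.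
Qed.

Lemma oscN w p q i x : osc w (- p) (- q) i x = - osc w p q i x.
Proof.
by elim: i p q => [|i IH] p q /=; rewrite ?mulNr ?opprD// IH mulrN.
Qed.

Lemma osc2 w p q i x : osc w p q i.+2 x = - w ^+ 2 * osc w p q i x.
Proof. by rewrite /= oscN; ring. Qed.

Lemma osc_lin w p q (c : R) i x : osc w (c * p) (c * q) i x = c * osc w p q i x.
Proof.
elim: i p q => [|i IH] p q /=; first ring.
by rewrite -mulrN IH; ring.
Qed.

Lemma expo4 z p q i x : expo z p q i.+4 x = z ^+ 4 * expo z p q i x.
Proof. rewrite /expo !exprS expr0; ring. Qed.

(** This is [sinh t > sin t], which holds since the derivative
    [2 cosh - 2 cos] of twice the difference is positive on positive reals. *)
Lemma expR_sin (t : R) : 0 < t -> 0 < expR t ^+ 2 - 2 * expR t * sin t - 1.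
Proof.
move=> t0; pose h y : R := expR y - expR (- y) - 2 * sin y.
have dh y : is_derive y 1 h (expR y + expR (- y) - 2 * cos y).
  have h1 : is_derive y 1 (fun y => expR (- y)) (- expR (- y)).
    have := @is_derive_comp_lin (@expR R) (-1) y _ (is_derive_expR _).
    by move/is_derive_eqfun; apply => [x|]; rewrite !mulN1r.
  by apply: (is_derive_eqfun (f := (@expR R - (fun y => expR (- y))) - 2 \*: @sin R)) => //;
    rewrite /GRing.scale /=; ring.
have [c] := MVT t0 (fun y _ => dh y)
  (continuous_subspaceT (fun y => is_derive_cont (dh y))).
rewrite in_itv /= => /andP[c0 _].
rewrite {2}/h oppr0 subrr sin0 mulr0 !subr0 => ht.
have E1 : 1 < expR c by rewrite -expR0 ltr_expR.
have h0 : 0 < h t.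
  rewrite ht addr0 mulr_gt0 //; have := expRxMexpNx_1 c; have := cos_le1 c; nra.
have Et : 0 < expR t by exact: expR_gt0.
have := mulr_gt0 Et h0; rewrite /h mulrBr mulrBr expRxMexpNx_1.
nra.
Qed.

(** The string motion with initial state [(p, q)] in the normalisation of the
    transfer matrices. *)
Definition string_wave z p q : nat -> R -> R := osc (z ^+ 2) p q.

Lemma string_wave2 z p q i x :
  string_wave z p q i.+2 x = - z ^+ 4 * string_wave z p q i x.
Proof. by rewrite /string_wave osc2 -exprM. Qed.

Lemma string_wave_end z p q x : z != 0 ->
  col2 (string_wave z p q 0 x) (string_wave z p q 1 x / z ^+ 2) =
  mx2 (cos (x * z ^+ 2)) (sin (x * z ^+ 2)) (- sin (x * z ^+ 2)) (cos (x * z ^+ 2))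
    *m col2 p q.
Proof.
move=> z0; rewrite mul_mx2_col2 /string_wave /= [z ^+ 2 * x]mulrC.
by congr col2; field.
Qed.

Lemma string_wave0 z p q : string_wave z p q 0 0 = p /\ string_wave z p q 1 0 = z ^+ 2 * q.
Proof. by rewrite /string_wave /= mulr0 cos0 sin0 !mulr1 !mulr0 !addr0. Qed.

Definition beam_det a z : R := expR (z * a) ^+ 2 - 2 * expR (z * a) * sin (z * a) - 1.

(** The coefficient of [sin (z x)] that makes the moment vanish at [a]. *)
Definition beam_sin a z p q : R :=
  - (p / 2 * (expR (z * a) ^+ 2 - 2 * expR (z * a) * cos (z * a) + 1)
     + q * (expR (z * a) ^+ 2 - 1)) / beam_det a z.

(** The beam motion with initial state [(p, q)] and without moment at either
    end.  The moment at [0] vanishes because [cos] and [cosh] both have the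
    coefficient [p / 2]. *)
Definition beam_wave a z p q i x : R :=
  osc z (p / 2) (beam_sin a z p q) i x
  + expo z (p / 4 + (q + beam_sin a z p q) / 2) (p / 4 - (q + beam_sin a z p q) / 2) i x.

Lemma beam_wave4 a z p q i x : beam_wave a z p q i.+4 x = z ^+ 4 * beam_wave a z p q i x.
Proof. rewrite /beam_wave expo4 !osc2; ring. Qed.

Lemma beam_wave0 a z p q : beam_wave a z p q 0 0 = p /\
  beam_wave a z p q 2 0 = 0 /\ beam_wave a z p q 3 0 = z ^+ 3 * q.
Proof.
rewrite /beam_wave /expo /=; set b := beam_sin _ _ _ _.
by rewrite !mulr0 cos0 sin0 expR0; split; [|split]; field.
Qed.

Lemma beam_det_neq0 a z : 0 < a -> 0 < z -> beam_det a z != 0.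
Proof. by move=> a0 z0; rewrite gt_eqF// expR_sin// mulr_gt0. Qed.

(** The two initial values that are not part of the state are fixed by the
    absence of moments: at [0] directly, at [a] through a linear equation whose
    coefficient is [beam_det]. *)
Lemma solves_beam z a v i x : 0 < z -> 0 < a -> solves 4 (z ^+ 4) a v ->
  v 2%N 0 = 0 -> v 2%N a = 0 -> (i < 4)%N -> x \in `[0, a] ->
  v i x = beam_wave a z (v 0%N 0) (v 3%N 0 / z ^+ 3) i x.
Proof.
move=> z0 a0 sv v20 v2a ni xa; have zn0 : z != 0 by rewrite gt_eqF.
pose p := v 0%N 0; pose q := v 3%N 0 / z ^+ 3; pose b := (v 1%N 0 / z - q) / 2.
pose w i x := osc z (p / 2) b i x + expo z (p / 4 + (q + b) / 2) (p / 4 - (q + b) / 2) i x.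
have sw : solves 4 (z ^+ 4) a w.
  apply: smooth_solves; first by apply: smoothD; [exact: smooth_osc|exact: smooth_expo].
  by move=> y; rewrite /w expo4 !osc2; ring.
have vw j y : (j < 4)%N -> y \in `[0, a] -> v j y = w j y.
  move=> nj ya; apply/eqP; rewrite -subr_eq0 -mulN1r; apply/eqP.
  apply: (solves_unique (solves_lin (-1) sv sw) _ nj ya) => -[|[|[|[|//]]]] _.
  - by rewrite /w /expo /= !mulr0 cos0 sin0 expR0 -/p; field.
  - by rewrite /w /expo /= !mulr0 cos0 sin0 expR0 /b; field.
  - by rewrite /w /expo /= !mulr0 cos0 sin0 expR0 v20; field.
  - by rewrite /w /expo /= !mulr0 cos0 sin0 expR0 (_ : v 3%N 0 = z ^+ 3 * q) ?/q; field => //.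
rewrite vw// /beam_wave; suff -> : beam_sin a z p q = b by [].
have D0 := beam_det_neq0 a0 z0.
apply: (mulIf D0); rewrite /beam_sin divfK //.
have E0 : expR (z * a) != 0 by rewrite gt_eqF ?expR_gt0.
have aa : a \in `[0, a] by rewrite in_itv /= lexx ltW.
move: v2a; rewrite vw // /w /expo /= (mulNr z a) expRN => h.
apply/eqP; rewrite -subr_eq0; apply/eqP.
(* The moment at [a] vanishes; multiplying it by [2 e^(za) / z^2] gives the
   linear equation that [b] solves. *)
transitivity (- 2 * expR (z * a) * z ^- 2 *
    (z * (z * (- (p / 2) * cos (z * a) + - b * sin (z * a))) +
     ((p / 4 + (q + b) / 2) * z ^+ 2 * expR (z * a) +
      (p / 4 - (q + b) / 2) * (- z) ^+ 2 * (expR (z * a))^-1))); last by rewrite h mulr0.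
rewrite /beam_det; field.
by rewrite E0 zn0.
Qed.

Lemma beam_wave_end z p q a : 0 < z -> 0 < a ->
  beam_wave a z p q 2 a = 0 /\
  col2 (beam_wave a z p q 0 a) (beam_wave a z p q 3 a / z ^+ 3) =
  (let E := expR (a * z) in let c := cos (a * z) in let s := sin (a * z) in
   (E ^+ 2 - 2 * E * s - 1)^-1 *:
    mx2 (E ^+ 2 * (c - s) - c - s) (2 * s * (1 - E ^+ 2))
        (E ^+ 2 * c - 2 * E + c)   (E ^+ 2 * (c - s) - c - s)) *m col2 p q.
Proof.
move=> z0 a0; have zn0 : z != 0 by rewrite gt_eqF.
have := beam_det_neq0 a0 z0.
rewrite /= scale_mx2 mul_mx2_col2 /beam_wave /expo /= (mulNr z a) expRN /beam_sin /beam_det.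
rewrite [a * z]mulrC.
have : expR (z * a) != 0 by rewrite gt_eqF ?expR_gt0.
have := cos2Dsin2 (z * a).
move: (expR _) (cos _) (sin _) => E c s cs E0 D0.
have s2 : s ^+ 2 = 1 - c ^+ 2 by rewrite -cs; ring.
split; first by field; rewrite E0 D0.
congr col2; first by field; rewrite E0 D0.
by field: s2; rewrite D0 E0 zn0.
Qed.

End Waves.

(** * Square integrable functions and Sobolev jets *)

Section ComplexParts.
Variable R : realType.
Implicit Types (u w : R[i]).

Lemma cReD u w : complex.Re (u + w) = complex.Re u + complex.Re w.
Proof. by case: u w => [a b] [c d]. Qed.

Lemma cImD u w : complex.Im (u + w) = complex.Im u + complex.Im w.
Proof. by case: u w => [a b] [c d]. Qed.

Lemma cReN u : complex.Re (- u) = - complex.Re u.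
Proof. by case: u. Qed.

Lemma cImN u : complex.Im (- u) = - complex.Im u.
Proof. by case: u. Qed.

Lemma cReM u w :
  complex.Re (u * w) = complex.Re u * complex.Re w - complex.Im u * complex.Im w.
Proof. by case: u w => [a b] [c d]. Qed.

Lemma cImM u w :
  complex.Im (u * w) = complex.Re u * complex.Im w + complex.Im u * complex.Re w.
Proof. by case: u w => [a b] [c d]. Qed.

Lemma complex_ext u w :
  complex.Re u = complex.Re w -> complex.Im u = complex.Im w -> u = w.
Proof. by case: u w => [a b] [c d] /= -> ->. Qed.

Lemma normc2_ge0 u : 0 <= normc2 u.
Proof. by rewrite addr_ge0// sqr_ge0. Qed.

Lemma normc2M u w : normc2 (u * w) = normc2 u * normc2 w.
Proof. rewrite /normc2 cReM cImM; ring. Qed.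

Lemma normc2_eq0 u : normc2 u = 0 -> u = 0.
Proof.
case: u => a b /eqP; rewrite paddr_eq0 ?sqr_ge0//= !sqrf_eq0.
by case/andP => /eqP-> /eqP->.
Qed.

Lemma normc2_0 : normc2 (0 : R[i]) = 0.
Proof. by rewrite /normc2 /= expr0n addr0. Qed.

End ComplexParts.

(** Instance search depends on the form of the measure; this is the one in which
    it occurs in the definition of the norms. *)
#[local] Instance ae_lebesgue_filter (R : realType) :
  Filter (nbhs (almost_everywhere (@lebesgue_measure R))).
Proof. exact: ae_filter_ringOfSetsType. Qed.

Section NullFunctions.
Variable R : realType.
Local Notation C := R[i].
Local Notation mu := (@lebesgue_measure R).
Implicit Types (u w : R -> C) (a : R).

Definition cmeasurable a u : Prop :=
  measurable_fun `[0, a] (re u) /\ measurable_fun `[0, a] (im u).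

Lemma cmeasurableD a u w : cmeasurable a u -> cmeasurable a w ->
  cmeasurable a (fun x => u x + w x).
Proof.
move=> [ru iu] [rw iw]; split.
  rewrite (_ : re _ = re u \+ re w); first exact: measurable_funD.
  by apply/funext => x; rewrite /re cReD.
rewrite (_ : im _ = im u \+ im w); first exact: measurable_funD.
by apply/funext => x; rewrite /im cImD.
Qed.

Lemma cmeasurableM a (c : C) u : cmeasurable a u -> cmeasurable a (fun x => c * u x).
Proof.
move=> [ru iu]; split.
  rewrite (_ : re _ = (fun x => complex.Re c * re u x - complex.Im c * im u x)).
    by apply: measurable_funB; apply: measurable_funM.
  by apply/funext => x; rewrite /re cReM.
rewrite (_ : im _ = (fun x => complex.Re c * im u x + complex.Im c * re u x)).
  by apply: measurable_funD; apply: measurable_funM.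
by apply/funext => x; rewrite /im cImM.
Qed.

Lemma cmeasurable0 a : cmeasurable a (fun=> 0).
Proof. by split; exact: measurable_cst. Qed.

Lemma L2_cmeasurable a u : L2 a u -> cmeasurable a u.
Proof. by case. Qed.

Lemma measurable_normc2 a u :
  cmeasurable a u -> measurable_fun `[0, a] (fun x => (normc2 (u x))%:E).
Proof.
move=> [ru iu]; apply/measurable_EFinP.
apply: measurable_funD; apply: measurable_funX; [exact: ru|exact: iu].
Qed.

Definition ae_zero a u : Prop := {ae mu, forall x, `[0, a]%classic x -> u x = 0}.

Lemma L2norm2_eq0 a u : cmeasurable a u -> L2norm2 a u = 0%E <-> ae_zero a u.
Proof.
move=> mu_; have H := ae_eq_integral_abs mu (measurable_itv _) (measurable_normc2 mu_).
rewrite /L2norm2.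
under eq_integral => x _ do rewrite -[normc2 _]ger0_norm ?normc2_ge0// -abse_EFin.
rewrite H; split; apply: filterS => x ux x0a.
  by have [/normc2_eq0] := ux x0a.
by rewrite ux// normc2_0.
Qed.

Lemma ae_zeroD a u w : ae_zero a u -> ae_zero a w -> ae_zero a (fun x => u x + w x).
Proof. by apply: filterS2 => x u0 w0 xa; rewrite u0// w0// addr0. Qed.

Lemma ae_zeroM a (c : C) u : ae_zero a u -> ae_zero a (fun x => c * u x).
Proof. by apply: filterS => x u0 xa; rewrite u0// mulr0. Qed.

End NullFunctions.

Section Sobolev.
Variable R : realType.
Local Notation C := R[i].
Local Notation mu := (@lebesgue_measure R).
Implicit Types (f g : R -> R) (a x k : R) (n : nat) (u : jet R).

Lemma integrable_continuous a f :
  {within `[0, a], continuous f} -> mu.-integrable `[0, a] (EFin \o f).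
Proof. by apply: continuous_compact_integrable; exact: segment_compact. Qed.

(** On a bounded interval, [|r| <= 1 + r ^+ 2] gives integrability. *)
Lemma L2_integrable a (w : R -> C) : L2 a w ->
  mu.-integrable `[0, a] (EFin \o re w) /\ mu.-integrable `[0, a] (EFin \o im w).
Proof.
move=> [mr mi iw].
have i1 : mu.-integrable `[0, a] (fun x => (1 + normc2 (w x))%:E).
  have h1 := integrable_continuous
    (@continuous_subspaceT _ _ `[0, a]%classic (cst (1 : R))
      (fun x => @cst_continuous _ _ _ x)).
  rewrite (_ : (fun _ => _) = (EFin \o cst 1) \+ (fun x => (normc2 (w x))%:E)) //.
  exact: integrableD.
have sq (r : R) : `|r| <= 1 + r ^+ 2.
  rewrite -[r ^+ 2]real_normK ?num_real//; have := sqr_ge0 (`|r| - 1); nra.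
split; apply: le_integrable i1 => //; try exact/measurable_EFinP.
  move=> x _; rewrite /= lee_fin [leRHS]ger0_norm; last exact: addr_ge0 ler01 (normc2_ge0 _).
  by rewrite (le_trans (sq _))// lerD2l lerDl ?sqr_ge0.
move=> x _; rewrite /= lee_fin [leRHS]ger0_norm; last exact: addr_ge0 ler01 (normc2_ge0 _).
by rewrite (le_trans (sq _))// lerD2l lerDr ?sqr_ge0.
Qed.

Lemma Rintegral_derive f g x : 0 <= x -> (forall y : R, is_derive y 1 f (g y)) ->
  continuous g -> Rintegral mu `[0, x] g = f x - f 0.
Proof.
rewrite le_eqVlt => /predU1P[<- _ _|x0 df cg].
  by rewrite set_itv1 Rintegral_set1 subrr.
have fc : continuous f by move=> y; exact: (is_derive_cont (df y)).
rewrite /Rintegral (continuous_FTC2 x0 (F := f)) //.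
- exact: continuous_subspaceT.
- split; first by move=> y _; case: (df y).
    by apply: cvg_at_right_filter; exact: fc.
  by apply: cvg_at_left_filter; exact: fc.
- by move=> y _; rewrite derive1E; case: (df y).
Qed.

Lemma primitive_continuous a f g : 0 <= a -> mu.-integrable `[0, a] (EFin \o g) ->
  (forall x, x \in `[0, a] -> f x = f 0 + Rintegral mu `[0, x] g) ->
  {within `[0, a], continuous f}.
Proof.
move=> a0 ig fE; have cI := parameterized_integral_continuous a0 ig.
apply: (@subspace_eq_continuous _ _ _ (fun x => f 0 + Rintegral mu `[0, x] g)).
  by move=> x; rewrite inE => /fE.
apply: within_continuousD => //.
by apply: continuous_subspaceT => x; exact: cst_continuous.
Qed.

Lemma primitive_derive a f g x : mu.-integrable `[0, a] (EFin \o g) ->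
  (forall x, x \in `[0, a] -> f x = f 0 + Rintegral mu `[0, x] g) ->
  {within `[0, a], continuous g} -> x \in `]0, a[ -> is_derive x 1 f (g x).
Proof.
move=> ig fE cg xa; have := xa; rewrite in_itv /= => /andP[x0 xltA].
have cgx : {for x, continuous g}.
  by have /(continuous_within_itvP _ (lt_trans x0 xltA))[h _ _] := cg; exact: h.
have [dI DI] := continuous_FTC1_closed xltA ig x0 cgx.
refine (@near_eq_is_derive _ _ _ (fun y : R => f 0 + Rintegral mu `[0, y] g) f x 1 (g x) _ _).
  near=> y; apply/esym/fE; apply: subset_itv_oo_cc; near: y.
  exact: near_in_itvoo.
have dI' : is_derive x 1 (fun y => Rintegral mu `[0, y] g) (g x).
  by apply: (DeriveDef dI); rewrite -derive1E.
apply: (is_derive_eqfun (is_derive_add (is_derive_cst (f 0) x 1) dI') (frefl _)).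
by rewrite add0r.
Unshelve. all: by end_near. Qed.

(** Bootstrap: each [v i] is continuous as a primitive, hence so is its
    derivative [v i.+1]; for the last one the integrand can be replaced by the
    continuous function [k * v 0], to which it is equal almost everywhere. *)
Lemma jet_solves n k a (v : nat -> R -> R) : 0 <= a ->
  (forall i, (i <= n)%N -> mu.-integrable `[0, a] (EFin \o v i)) ->
  (forall i, (i < n)%N -> forall x, x \in `[0, a] ->
     v i x = v i 0 + Rintegral mu `[0, x] (v i.+1)) ->
  {ae mu, forall x, `[0, a]%classic x -> v n x = k * v 0%N x} ->
  solves n k a v.
Proof.
move=> a0 iv vE ae.
have cv i : (i < n)%N -> {within `[0, a], continuous (v i)}.
  by move=> ni; apply: (primitive_continuous a0 (iv i.+1 ni) (vE i ni)).
have cn i : (i < n)%N -> {within `[0, a], continuous (next_jet n k v i)}.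
  move=> ni; rewrite /next_jet; case: ifPn => [/eqP e|e]; last first.
    by apply: cv; rewrite ltn_neqAle e.
  apply: within_continuousM; last by apply: cv; rewrite -e.
  by apply: continuous_subspaceT => x; exact: cst_continuous.
move=> i ni; split; first exact: cv.
move=> x xa; apply: (@primitive_derive a) => //; last exact: cn.
  exact: integrable_continuous (cn i ni).
move=> y ya; rewrite (vE i ni y ya); congr (_ + _).
rewrite /next_jet; case: ifPn => // /eqP e.
have sub : `[0, y]%classic `<=` `[0, a]%classic.
  move=> t /=; rewrite !in_itv /= => /andP[-> ty] /=.
  by move: ya; rewrite in_itv /= => /andP[_]; exact: le_trans.
rewrite /Rintegral e; congr fine; apply: ae_eq_integral => //.
- by have /integrableP[m _] := iv n (leqnn n); exact: measurable_funS m.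
- have n0 : (0 < n)%N by rewrite -e.
  have /integrableP[m _] := integrable_continuous (cn i ni).
  by move: m; rewrite /next_jet e eqxx => m; exact: measurable_funS m.
- by apply: filterS ae => t h /sub/h ->.
Qed.

(** As [k] is real, the real and imaginary parts decouple. *)
Lemma sobolev_solves n k a u : 0 <= a -> sobolev n a u ->
  ae_zero a (fun x => u n x - Complex k 0 * u 0%N x) ->
  solves n k a (fun i => re (u i)) /\ solves n k a (fun i => im (u i)).
Proof.
move=> a0 [L2u uE] ae.
split; apply: jet_solves => //.
- by move=> i ni; have [] := L2_integrable (L2u i ni).
- by move=> i ni x xa; rewrite {1}/re (uE i ni x xa) cReD.
- apply: filterS ae => x h xa; have := congr1 (@complex.Re R) (h xa).
  by rewrite -mulN1r cReD !cReM /= => H; rewrite /re; lra.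
- by move=> i ni; have [] := L2_integrable (L2u i ni).
- by move=> i ni x xa; rewrite {1}/im (uE i ni x xa) cImD.
- apply: filterS ae => x h xa; have := congr1 (@complex.Im R) (h xa).
  by rewrite -mulN1r cImD !cImM /= => H; rewrite /im; lra.
Qed.

Lemma smooth_continuous v i : smooth v -> continuous (v i : R -> R).
Proof. by move=> sv x; exact: (is_derive_cont (sv i x)). Qed.

Lemma continuous_sqr f x : {for x, continuous f} -> {for x, continuous (fun y => f y ^+ 2)}.
Proof. by move=> cf; exact: continuousM. Qed.

Lemma L2_continuous a (w : R -> C) : continuous (re w) -> continuous (im w) -> L2 a w.
Proof.
move=> cr ci; split.
- by apply: measurable_funS (continuous_measurable_fun cr).
- by apply: measurable_funS (continuous_measurable_fun ci).
- apply: integrable_continuous; apply: continuous_subspaceT => x.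
  apply: (@continuousD _ _ _ (fun x => re w x ^+ 2) (fun x => im w x ^+ 2)).
    exact: continuous_sqr (cr x).
  exact: continuous_sqr (ci x).
Qed.

(** The eigenvectors constructed below are complex multiples of real functions,
    which reduces their study to real analysis. *)
Definition cjet (c : C) (v : nat -> R -> R) : jet R := fun i x => c * Complex (v i x) 0.

Lemma re_cjet c v i : re (cjet c v i) = fun x => complex.Re c * v i x.
Proof. by apply/funext => x; rewrite /re cReM /= mulr0 subr0. Qed.

Lemma im_cjet c v i : im (cjet c v i) = fun x => complex.Im c * v i x.
Proof. by apply/funext => x; rewrite /im cImM /= mulr0 add0r. Qed.

Lemma L2_cjet a c v i : smooth v -> L2 a (cjet c v i).
Proof.
move=> sv; apply: L2_continuous; rewrite ?re_cjet ?im_cjet => x;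
  by apply: continuousM; [exact: cst_continuous|exact: smooth_continuous].
Qed.

(** The fundamental theorem of calculus, in both components. *)
Lemma sobolev_cjet n a c v : smooth v -> sobolev n a (cjet c v).
Proof.
move=> sv; split=> [i _|i _ x]; first exact: L2_cjet.
rewrite in_itv /= => /andP[x0 _].
have H := Rintegral_derive x0 (fun y => sv i y) (@smooth_continuous v i.+1 sv).
have iv : mu.-integrable `[0, x] (EFin \o v i.+1).
  by apply: integrable_continuous; apply: continuous_subspaceT; exact: smooth_continuous.
rewrite /cintegral re_cjet im_cjet !RintegralZl // H.
by apply: complex_ext; rewrite ?cReD ?cImD /cjet ?cReM ?cImM /=; ring.
Qed.

Lemma L2norm2_cjet a c v i : smooth v ->
  L2norm2 a (cjet c v i) = (normc2 c * Rintegral mu `[0, a] (fun x => v i x ^+ 2))%:E.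
Proof.
move=> sv.
have iv : mu.-integrable `[0, a] (EFin \o (fun x => v i x ^+ 2)).
  apply: integrable_continuous; apply: continuous_subspaceT => x.
  by apply: continuous_sqr; exact: smooth_continuous.
rewrite /L2norm2 -RintegralZl // /Rintegral fineK; last first.
  apply: integrable_fin_num => //.
  by apply: (integrableZl _ _ iv).
apply: eq_integral => x _; congr (_%:E).
by rewrite /cjet normc2M /normc2 /= expr0n addr0.
Qed.

End Sobolev.

(** * Motions of the whole chain *)

Section Network.
Variables (R : realType) (N : nat) (l : nat -> R) (z : R).
Hypothesis hl : forall j : nat, (1 <= j <= N.*2)%N -> 0 < l j.
Hypothesis z_gt0 : 0 < z.
Implicit Types (v w : nat -> nat -> R -> R) (n i j : nat).

Let z_neq0 : z != 0. Proof. by rewrite gt_eqF. Qed.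

(** The boundary and transmission conditions in the domain of [Ac] except the one
    at the right end of the chain: without it there is a nonzero motion for
    every [z], and [charf l N z] measures how far it is from satisfying it. *)
Definition chained v : Prop :=
  [/\ forall j, (1 <= j < N.*2)%N -> v j 0%N (l j) = v j.+1 0%N 0,
      v 1%N 0%N 0 = 0,
      forall j, (1 <= j <= N)%N -> v j.*2 2%N 0 = 0 /\ v j.*2 2%N (l j.*2) = 0,
      forall j, (1 <= j <= N)%N -> v j.*2 3%N 0 + v j.*2.-1 1%N (l j.*2.-1) = 0 &
      forall j, (1 <= j < N)%N -> v j.*2 3%N (l j.*2) + v j.*2.+1 1%N 0 = 0].

Definition ode_order j : nat := (ordV j).*2.
Definition ode_coef j : R := if odd j then - z ^+ 4 else z ^+ 4.

Definition vibrates v : Prop :=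
  forall j, edge N j -> solves (ode_order j) (ode_coef j) (l j) (v j).

Lemma chained_lin v w (c : R) : chained v -> chained w ->
  chained (fun j i x => v j i x + c * w j i x).
Proof.
move=> [v1 v2 v3 v4 v5] [w1 w2 w3 w4 w5]; split.
- by move=> j hj; rewrite v1// w1.
- by rewrite v2 w2 mulr0 addr0.
- by move=> j hj; have [-> ->] := v3 j hj; have [-> ->] := w3 j hj; rewrite mulr0 addr0.
- by move=> j hj; rewrite addrACA -mulrDr v4// w4// mulr0 addr0.
- by move=> j hj; rewrite addrACA -mulrDr v5// w5// mulr0 addr0.
Qed.

Lemma vibrates_lin v w (c : R) : vibrates v -> vibrates w ->
  vibrates (fun j i x => v j i x + c * w j i x).
Proof. by move=> hv hw j ej; apply: solves_lin; [exact: hv|exact: hw]. Qed.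

Lemma string_edge n : (n < N)%N -> edge N n.*2.+1.
Proof. by move=> nN; rewrite /edge /= ltn_double. Qed.

Lemma string_inner n : (n < N)%N -> (1 <= n.*2.+1 < N.*2)%N.
Proof. by move=> nN; rewrite -[(_ < N.*2)%N]/(n.+1.*2 <= N.*2)%N leq_double. Qed.

Lemma beam_inner n : (n.+1 < N)%N -> (1 <= n.*2.+2 < N.*2)%N.
Proof. by move=> nN; rewrite -[(_ < N.*2)%N]/(n.+1.*2 < N.*2)%N ltn_double. Qed.

Lemma beam_edge n : (n < N)%N -> edge N n.*2.+2.
Proof. by move=> nN; rewrite /edge /= -doubleS leq_double. Qed.

Lemma edge_cases j : edge N j ->
  exists2 n, (n < N)%N & j = n.*2.+1 \/ j = n.*2.+2.
Proof.
move=> /andP[j1 jN]; exists j.-1./2.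
  by rewrite ltn_half_double prednK.
have := odd_double_half j.-1; case: odd => /= e; [right|left];
  by rewrite -[LHS](prednK j1) -{1}e.
Qed.

Lemma in_itv_end j : edge N j -> l j \in `[0, l j].
Proof. by move=> /hl lj; rewrite in_itv /= lexx ltW. Qed.

Lemma string_rigid w n : (n < N)%N -> vibrates w ->
  w n.*2.+1 0%N 0 = 0 -> w n.*2.+1 1%N 0 = 0 ->
  forall i x, (i < 2)%N -> x \in `[0, l n.*2.+1] -> w n.*2.+1 i x = 0.
Proof.
move=> nN hw w0 w1 i x i2 xl; have := hw _ (string_edge nN).
rewrite /ode_order /ode_coef /ordV /= odd_double /= => hs.
by apply: (solves_unique hs) => // -[|[|//]] _.
Qed.

Lemma beam_wave_0 a i x : beam_wave a z 0 0 i x = 0.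
Proof.
rewrite /beam_wave /beam_sin !mul0r addr0 oppr0 !mul0r addr0 mul0r oppr0 addr0.
by have := osc_lin z 0 0 0 i x; rewrite mul0r => ->; rewrite /expo !mul0r !addr0.
Qed.

Lemma beam_rigid w n : (n < N)%N -> chained w -> vibrates w ->
  w n.*2.+2 0%N 0 = 0 -> w n.*2.+2 3%N 0 = 0 ->
  forall i x, (i < 4)%N -> x \in `[0, l n.*2.+2] -> w n.*2.+2 i x = 0.
Proof.
move=> nN [_ _ w2 _ _] hw w0 w3 i x i4 xl; have := hw _ (beam_edge nN).
rewrite /ode_order /ode_coef /ordV /= odd_double /= => hs.
have [|w20 w2l] := w2 n.+1; first exact: nN.
rewrite (solves_beam z_gt0 (hl (beam_edge nN)) hs) //.
by rewrite w0 w3 mul0r beam_wave_0.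
Qed.

(** With zero displacement and strain at its left end a string is at rest; the
    transmission conditions then make displacement and shear vanish at the left
    end of the next beam, which together with the absence of moments keeps it at
    rest, and so on along the chain. *)
Lemma chained_rigid w : chained w -> vibrates w -> w 1%N 1%N 0 = 0 ->
  forall j i x, edge N j -> (i < ode_order j)%N -> x \in `[0, l j] -> w j i x = 0.
Proof.
move=> cw hw w110; have [w1 w2 w3 w4 w5] := cw.
have string_to_beam n : (n < N)%N ->
    w n.*2.+1 0%N 0 = 0 -> w n.*2.+1 1%N 0 = 0 ->
    w n.*2.+2 0%N 0 = 0 /\ w n.*2.+2 3%N 0 = 0.
  move=> nN e0 e1; have rig := string_rigid nN hw e0 e1.
  have el := in_itv_end (string_edge nN).
  split; first by rewrite -w1 ?string_inner// rig.
  by have := w4 n.+1; rewrite /= rig // addr0; apply.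
have data n : (n < N)%N -> w n.*2.+1 0%N 0 = 0 /\ w n.*2.+1 1%N 0 = 0.
  elim: n => [//|n IH] nN; have [e0 e1] := IH (ltnW nN).
  have [b0 b3] := string_to_beam n (ltnW nN) e0 e1.
  have rig := beam_rigid (ltnW nN) cw hw b0 b3.
  have el := in_itv_end (beam_edge (ltnW nN)).
  split; first by rewrite -w1 ?beam_inner// rig.
  by have := w5 n.+1; rewrite /= rig // add0r; apply.
move=> j i x ej; have [n nN [->|->]] := edge_cases ej; have [e0 e1] := data n nN.
  by rewrite /ode_order /ordV /= odd_double; exact: string_rigid.
rewrite /ode_order /ordV /= odd_double; have [b0 b3] := string_to_beam n nN e0 e1.
exact: beam_rigid.
Qed.

(** The motion with [Phi = 0] and [Phi' = z ^+ 2] at the left end of the chain. *)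
Definition wave j : nat -> R -> R :=
  let s := string_in l j./2 z in let b := beam_in l j./2.-1 z in
  if odd j then string_wave z (s 0 0) (s 1 0) else beam_wave (l j) z (b 0 0) (b 1 0).

Lemma wave_string n :
  wave n.*2.+1 = string_wave z (string_in l n z 0 0) (string_in l n z 1 0).
Proof. by rewrite /wave /= odd_double /= uphalf_double. Qed.

Lemma wave_beam n :
  wave n.*2.+2 = beam_wave (l n.*2.+2) z (beam_in l n z 0 0) (beam_in l n z 1 0).
Proof. by rewrite /wave /= odd_double /= doubleK. Qed.

Lemma smooth_wave j : smooth (wave j).
Proof.
rewrite /wave; case: ifP => _; first exact: smooth_osc.
by apply: smoothD; [exact: smooth_osc|exact: smooth_expo].
Qed.

(** Holding for every [i] and not only for [i = 0], this makes [wave_state] an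
    exact eigenvector in all the entries of its jets. *)
Lemma wave_eq j i x : wave j (i + ode_order j)%N x = ode_coef j * wave j i x.
Proof.
rewrite /wave /ode_order /ode_coef /ordV; case: ifP => _; rewrite ?addn2 ?addn4.
  exact: string_wave2.
exact: beam_wave4.
Qed.

Lemma vibrates_wave : vibrates wave.
Proof.
move=> j _; apply: smooth_solves; first exact: smooth_wave.
by move=> x; rewrite -wave_eq add0n.
Qed.

Lemma beam_in_wave n : beam_in l n z =
  col2 (wave n.*2.+1 0%N (l n.*2.+1)) (- wave n.*2.+1 1%N (l n.*2.+1) / z ^+ 3).
Proof.
rewrite /beam_in wave_string [in LHS](col2E (string_in l n z)).
have := string_wave_end (string_in l n z 0 0) (string_in l n z 1 0) (l n.*2.+1) z_neq0.
rewrite /string_mx /cs /sn /phase /= odd_double /= => <-.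
by rewrite mul_mx2_col2; congr col2; field.
Qed.

Lemma beam_out_wave n : (n < N)%N -> beam_out l n z =
  col2 (wave n.*2.+2 0%N (l n.*2.+2)) (wave n.*2.+2 3%N (l n.*2.+2) / z ^+ 3).
Proof.
move=> nN; rewrite /beam_out wave_beam [in LHS](col2E (beam_in l n z)).
have [_ ->] := beam_wave_end (beam_in l n z 0 0) (beam_in l n z 1 0) z_gt0 (hl (beam_edge nN)).
by rewrite /beam_mx /cs /sn /phase /= odd_double.
Qed.

Lemma string_in_wave n : (n < N)%N -> string_in l n.+1 z =
  col2 (wave n.*2.+2 0%N (l n.*2.+2)) (- wave n.*2.+2 3%N (l n.*2.+2) / z ^+ 2).
Proof.
move=> nN; rewrite string_inS beam_out_wave // invmx_T // mul_mx2_col2.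
by congr col2; field.
Qed.

Lemma chained_wave : chained wave.
Proof.
split.
- move=> j /andP[j1 jN].
  have [|n nN [e|e]] := @edge_cases j; first by rewrite /edge j1 ltnW.
    by rewrite e wave_beam (beam_wave0 _ _ _ _).1 beam_in_wave col2_0.
  have nN' : (n.+1 < N)%N by move: jN; rewrite e -doubleS ltn_double.
  by rewrite e -doubleS wave_string (string_wave0 _ _ _).1 string_in_wave ?(ltnW nN') // col2_0.
- by rewrite (wave_string 0) (string_wave0 _ _ _).1 /= col2_0.
- move=> [//|n] nN; rewrite wave_beam; split.
    by have [_ []] := beam_wave0 (l n.*2.+2) z (beam_in l n z 0 0) (beam_in l n z 1 0).
  by have [] := beam_wave_end (beam_in l n z 0 0) (beam_in l n z 1 0) z_gt0 (hl (beam_edge nN)).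
- move=> [//|n] nN; rewrite wave_beam.
  have [_ [_ ->]] := beam_wave0 (l n.*2.+2) z (beam_in l n z 0 0) (beam_in l n z 1 0).
  by rewrite beam_in_wave col2_1 /=; field.
- move=> [//|n] /ltnW nN; rewrite wave_string (string_wave0 _ _ _).2 string_in_wave // col2_1.
  by rewrite doubleS; field.
Qed.

Lemma wave_end n : N = n.+1 -> wave N.*2 0%N (l N.*2) = charf l N z.
Proof. by move=> e; rewrite e charf_beam_out beam_out_wave ?e// col2_0. Qed.

Lemma wave_strain : wave 1%N 1%N 0 = z ^+ 2.
Proof. by rewrite (wave_string 0) (string_wave0 _ _ _).2 col2_1 mulr1. Qed.

(** By [chained_rigid], [v] is [wave] multiplied by a scalar; at the right end
    the scalar times [charf] vanishes. *)
Lemma chained_end v : (1 <= N)%N -> chained v -> vibrates v ->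
  v N.*2 0%N (l N.*2) = 0 -> charf l N z != 0 ->
  forall j i x, edge N j -> (i < ode_order j)%N -> x \in `[0, l j] -> v j i x = 0.
Proof.
move=> N1 cv hv vend f0; pose c := - (v 1%N 1%N 0 / z ^+ 2).
have rig := chained_rigid (chained_lin c cv chained_wave) (vibrates_lin c hv vibrates_wave).
have {}rig j i x := rig _ j i x; move: rig.
rewrite wave_strain /c mulNr divfK ?expf_neq0// subrr => /(_ erefl) rig.
have eN : edge N N.*2 by rewrite /edge leqnn double_gt0 N1.
have c0 : v 1%N 1%N 0 / z ^+ 2 = 0.
  have := rig N.*2 0%N (l N.*2) eN.
  rewrite /ode_order /ordV odd_double => /(_ isT (in_itv_end eN)).
  rewrite vend add0r (@wave_end N.-1) ?prednK// => /eqP.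
  by rewrite mulf_eq0 (negPf f0) orbF oppr_eq0 => /eqP.
move=> j i x ej ij xl; have := rig j i x ej ij xl.
by rewrite c0 oppr0 mul0r addr0.
Qed.

End Network.

(** * Eigenvectors and the Riesz projection *)

Section EnergyNorm.
Variables (R : realType) (N : nat) (l : nat -> R).
Local Notation C := R[i].
Implicit Types (x y : state R) (i j : nat).

Lemma L2norm2_ge0 (a : R) (u : R -> C) : (0 <= L2norm2 a u)%E.
Proof. by apply: integral_ge0 => x _; rewrite lee_fin normc2_ge0. Qed.

Definition negligible_state x : Prop := forall j, edge N j ->
  (forall i, (i <= ordV j)%N -> L2norm2 (l j) (x.1 j i) = 0%E) /\
  L2norm2 (l j) (x.2 j 0%N) = 0%E.

Lemma normX2_eq0 x : normX2 N l x = 0%E <-> negligible_state x.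
Proof.
have s0 j : (0 <= \sum_(0 <= i < (ordV j).+1) L2norm2 (l j) (x.1 j i))%E.
  by apply: sume_ge0 => i _; exact: L2norm2_ge0.
split=> [|neg].
  rewrite /normX2 big_nat_cond => /eqP; rewrite seq_psume_eq0; last first.
    by move=> j _; rewrite adde_ge0// L2norm2_ge0.
  move=> /allP h j /andP[j1 jN].
  have := h j; rewrite mem_index_iota ltnS j1 jN => /(_ isT)/=.
  rewrite padde_eq0 ?L2norm2_ge0// => /andP[/eqP h1 /eqP h2]; split=> // i ij.
  move: h1; rewrite big_nat_cond => /eqP.
  rewrite seq_psume_eq0; last by move=> *; exact: L2norm2_ge0.
  by move=> /allP/(_ i); rewrite mem_index_iota ltnS ij => /(_ isT)/=/eqP.
rewrite /normX2 big_nat_cond big1// => j; rewrite andbT ltnS => /neg[h1 ->].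
rewrite adde0 big_nat_cond big1// => i; rewrite andbT /= ltnS; exact: h1.
Qed.

End EnergyNorm.

Section Eigenvectors.
Variables (R : realType) (N : nat) (l : nat -> R) (z : R).
Hypothesis hN : (1 <= N)%N.
Hypothesis hl : forall j : nat, (1 <= j <= N.*2)%N -> 0 < l j.
Hypothesis z_gt0 : 0 < z.
Local Notation C := R[i].
Implicit Types (y : state R) (c d lam : C).

Definition nu : C := Complex 0 (z ^+ 2).

Lemma nu2 : nu * nu = Complex (- z ^+ 4) 0.
Proof. by apply: complex_ext; rewrite ?cReM ?cImM /=; ring. Qed.

(** Eliminating the velocity component from the eigenvalue equation; the sign
    [e] below accounts for the minus sign of the beam equation. *)
Lemma eigenvector_ae y : inY N l y -> eqX N l (Ac y) (sscale nu y) ->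
  forall j, edge N j ->
    ae_zero (l j) (fun x => y.2 j 0%N x - nu * y.1 j 0%N x) /\
    ae_zero (l j) (fun x => y.1 j (ode_order j) x - Complex (ode_coef z j) 0 * y.1 j 0%N x).
Proof.
move=> [[sV _ _ _] [sW _ _ _] sY _ _] /normX2_eq0 neg j ej.
have m1 i : (i <= (ordV j).*2)%N -> cmeasurable (l j) (y.1 j i).
  by move=> ij; apply/L2_cmeasurable/(sY j ej).1.
have m2 i : (i <= ordV j)%N -> cmeasurable (l j) (y.2 j i).
  by move=> ij; apply/L2_cmeasurable/(sW j ej).1.
have [h1 h2] := neg j ej.
have a1 : ae_zero (l j) (fun x => y.2 j 0%N x - nu * y.1 j 0%N x).
  have mm := cmeasurableD (m2 0%N isT) (cmeasurableM (-1) (cmeasurableM nu (m1 0%N isT))).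
  have /(L2norm2_eq0 mm) := h1 0%N isT.
  by apply: filterS => x h xa; rewrite -mulN1r h.
split=> //.
pose e : C := if odd j then 1 else -1.
have AcE x : (Ac y).2 j 0%N x = e * y.1 j (ode_order j) x.
  by rewrite /Ac /= /e /ode_order /ordV; case: odd; rewrite ?mul1r ?mulN1r.
have mm : cmeasurable (l j) (fun x => (Ac y).2 j 0%N x + -1 * (nu * y.2 j 0%N x)).
  apply: cmeasurableD; last by do 2 apply: cmeasurableM; exact: m2.
  rewrite (_ : (Ac y).2 j 0%N = fun x => e * y.1 j (ode_order j) x); last exact/funext.
  by apply: cmeasurableM; exact: m1.
have a2 := (L2norm2_eq0 mm).1 h2.
have := ae_zeroD (ae_zeroM e a2) (ae_zeroM (e * nu) a1).
apply: filterS => x h xa; have := h xa; rewrite AcE => H.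
have e2 : e * e = 1 by rewrite /e; case: odd; rewrite ?mulr1 ?mulrNN ?mulr1.
have -> : Complex (ode_coef z j) 0 = e * (nu * nu).
  rewrite nu2 /ode_coef /e; case: odd; rewrite ?mul1r ?mulN1r //.
  by apply: complex_ext; rewrite /= ?opprK ?oppr0.
have -> : y.1 j (ode_order j) x = e * e * y.1 j (ode_order j) x by rewrite e2 mul1r.
by rewrite -[RHS]H; ring.
Qed.

(** The real and imaginary parts of an eigenvector satisfy the real problem, so
    [chained_end] forces both to vanish when [charf] does not. *)
Lemma eigenvalue_charf : eigenvalue_on N l (inY N l) nu -> charf l N z = 0.
Proof.
move=> [y [Yy y0 Ay]]; apply/eqP/negPn/negP => f0; apply: y0.
have ae := eigenvector_ae Yy Ay.
have [[sV VV V0 Vend] [sW _ _ _] sY Y2 [Y3 Y3']] := Yy.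
have part (P : C -> R) (PD : forall u w, P (u + w) = P u + P w) (P0 : P 0 = 0) :
    (forall j, edge N j -> solves (ode_order j) (ode_coef z j) (l j) (fun i x => P (y.1 j i x))) ->
    forall j i x, edge N j -> (i < ode_order j)%N -> x \in `[0, l j] -> P (y.1 j i x) = 0.
  move=> sol; apply: (chained_end hl z_gt0 hN _ sol) => //; last by rewrite Vend.
  split.
  - by move=> j hj; rewrite VV.
  - by rewrite V0.
  - by move=> j hj; have [-> ->] := Y2 j hj.
  - by move=> j hj; rewrite -PD Y3.
  - by move=> j hj; rewrite -PD Y3'.
have sol j (ej : edge N j) := sobolev_solves (ltW (hl ej)) (sY j ej) (ae j ej).2.
have re0 := part _ (@cReD R) erefl (fun j ej => (sol j ej).1).
have im0 := part _ (@cImD R) erefl (fun j ej => (sol j ej).2).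
have y10 j i x : edge N j -> (i < ode_order j)%N -> x \in `[0, l j] -> y.1 j i x = 0.
  by move=> ej ij xl; apply: complex_ext; [exact: re0|exact: im0].
have small j i : (i <= ordV j)%N -> (i < ode_order j)%N.
  by rewrite /ode_order /ordV; case: odd => ij; rewrite (leq_ltn_trans ij).
apply/normX2_eq0 => j ej; split=> [i ij|].
  have m : cmeasurable (l j) (y.1 j i) by apply/L2_cmeasurable/(sV j ej).1.
  apply/(L2norm2_eq0 (cmeasurableD m (cmeasurableM (-1) (cmeasurable0 _)))).
  by apply: nearW => x xl; rewrite mulr0 addr0 y10 ?small.
have m : cmeasurable (l j) (y.2 j 0%N) by apply/L2_cmeasurable/(sW j ej).1.
apply/(L2norm2_eq0 (cmeasurableD m (cmeasurableM (-1) (cmeasurable0 _)))).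
apply: filterS (ae j ej).1 => x h xl; have := h xl.
by rewrite mulr0 addr0 y10 ?small// mulr0 subr0.
Qed.

(** Keeping the scalar [c] as a parameter turns the operations on states needed
    for the Riesz projection into operations on complex numbers. *)
Definition wave_state c : state R :=
  (fun j => cjet c (wave l z j), fun j => cjet (nu * c) (wave l z j)).

Lemma wave_stateD c d : sadd (wave_state c) (wave_state d) = wave_state (c + d).
Proof.
by congr pair; do 3 apply/funext => ?; rewrite /= /cjet ?mulrDr mulrDl.
Qed.

Lemma wave_stateZ c d : sscale c (wave_state d) = wave_state (c * d).
Proof.
by congr pair; do 3 apply/funext => ?; rewrite /= /cjet; ring.
Qed.

Lemma wave_state0 : wave_state 0 = szero R.
Proof.
by congr pair; do 3 apply/funext => ?; rewrite /= /cjet ?mulr0 mul0r.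
Qed.

Lemma wave_stateB c d : ssub (wave_state c) (wave_state d) = wave_state (c - d).
Proof. by rewrite /ssub wave_stateZ wave_stateD mulN1r. Qed.

Lemma Ac_wave_state c : Ac (wave_state c) = wave_state (nu * c).
Proof.
congr pair => /=; apply/funext => j; apply/funext => i; have h x := wave_eq l z j i x.
rewrite /ode_order /ode_coef /ordV in h.
case: ifP => oj; rewrite oj in h; apply/funext => x; rewrite /cjet.
  have := h x; rewrite addn2 => ->.
  by apply: complex_ext; rewrite /nu !(cReM, cImM) /=; ring.
have := h x; rewrite addn4 => ->.
by apply: complex_ext; rewrite /nu !(cReN, cImN, cReM, cImM) /=; ring.
Qed.

Lemma wave_inV c : charf l N z = 0 -> inV N l (fun j => cjet c (wave l z j)).
Proof.
move=> f0; have [w1 w2 _ _ _] := chained_wave hl z_gt0; split.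
- by move=> j _; apply: sobolev_cjet; exact: smooth_wave.
- by move=> j hj; rewrite /cjet w1.
- by rewrite /cjet w2 mulr0.
- by rewrite /cjet (@wave_end _ _ _ _ hl z_gt0 N.-1) ?prednK// f0 mulr0.
Qed.

Lemma wave_inY c : charf l N z = 0 -> inY N l (wave_state c).
Proof.
move=> f0; have [_ _ w3 w4 w5] := chained_wave hl z_gt0.
split; [exact: wave_inV|exact: wave_inV| | |split].
- by move=> j _; apply: sobolev_cjet; exact: smooth_wave.
- by move=> j hj; rewrite /wave_state /cjet /=; have [-> ->] := w3 j hj; rewrite mulr0.
- move=> j hj; rewrite /wave_state /cjet /= -mulrDr.
  by apply: complex_ext; rewrite !(cReM, cImM, cReD, cImD) /= w4//; ring.
- move=> j hj; rewrite /wave_state /cjet /= -mulrDr.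
  by apply: complex_ext; rewrite !(cReM, cImM, cReD, cImD) /= w5//; ring.
Qed.

Lemma wave_inX c : charf l N z = 0 -> inX N l (wave_state c).
Proof.
by move=> f0; split=> [|j _]; [exact: wave_inV|apply: L2_cjet; exact: smooth_wave].
Qed.

Lemma normX2_wave : exists K : R, forall c, normX2 N l (wave_state c) = (normc2 c * K)%:E.
Proof.
pose I j i := Rintegral (@lebesgue_measure R) `[0, l j] (fun x => wave l z j i x ^+ 2).
exists (\sum_(1 <= j < N.*2.+1) (\sum_(0 <= i < (ordV j).+1) I j i + normc2 nu * I j 0%N)) => c.
rewrite /normX2 mulr_sumr -sumEFin; apply: eq_bigr => j _.
rewrite mulrDr mulr_sumr EFinD -sumEFin; congr (_ + _)%E.
  by apply: eq_bigr => i _; apply: L2norm2_cjet; exact: smooth_wave.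
by rewrite L2norm2_cjet; [rewrite normc2M mulrCA mulrA|exact: smooth_wave].
Qed.

Lemma eqX_wave c d : c = d -> eqX N l (wave_state c) (wave_state d).
Proof.
move=> ->; have [K KE] := normX2_wave.
by rewrite /eqX wave_stateB subrr KE normc2_0 mul0r.
Qed.

(** On the first string [z ^+ 4 * w 0 ^+ 2 + w 1 ^+ 2] is the constant [z ^+ 4],
    so [w 0] and [w 1] cannot both have norm [0]. *)
Lemma wave_neq0 : ~ eqX N l (wave_state 1) (szero R).
Proof.
rewrite -wave_state0 /eqX wave_stateB subr0 => /normX2_eq0/(_ 1%N).
have e1 : edge N 1 by rewrite /edge double_gt0 hN.
have l1 := hl e1.
move=> /(_ e1)[h _]; have := h 0%N isT; have := h 1%N isT => /=.
have sw := smooth_wave l z 1.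
rewrite !L2norm2_cjet // /normc2 /= expr1n expr0n addr0 !mul1r => -[i1] [i0].
set w := wave l z 1 in sw i0 i1.
have int i : (@lebesgue_measure R).-integrable `[0, l 1%N] (EFin \o (fun x => w i x ^+ 2)).
  apply: integrable_continuous; apply: continuous_subspaceT => x.
  by apply: continuous_sqr; exact: smooth_continuous.
have wE x : z ^+ 4 * w 0%N x ^+ 2 + w 1%N x ^+ 2 = z ^+ 4.
  rewrite /w (wave_string l z 0) /string_wave /= !mxE /=.
  transitivity (z ^+ 4 * (cos (z ^+ 2 * x) ^+ 2 + sin (z ^+ 2 * x) ^+ 2)); first ring.
  by rewrite cos2Dsin2 mulr1.
have : Rintegral (@lebesgue_measure R) `[0, l 1%N]
    (fun x => z ^+ 4 * w 0%N x ^+ 2 + w 1%N x ^+ 2) = 0.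
  rewrite RintegralD //; last exact: (integrableZl _ _ (int 0%N)).
  by rewrite RintegralZl ?i0 ?i1 ?mulr0 ?addr0.
under eq_Rintegral => x _ do rewrite wE.
rewrite Rintegral_cst //= lebesgue_measure_itv /= lte_fin l1 /= subr0 => /eqP.
by rewrite mulf_eq0 expf_eq0 /= !gt_eqF.
Qed.

Lemma charf_eigenvalue : charf l N z = 0 -> eigenvalue_on N l (inY N l) nu.
Proof.
move=> f0; exists (wave_state 1); split; [exact: wave_inY|exact: wave_neq0|].
by rewrite Ac_wave_state wave_stateZ; exact: eqX_wave.
Qed.

Lemma csumX_wave (gam : R -> C) (F : C -> C) n :
  csumX gam (fun lam => wave_state (F lam)) n = wave_state (csum gam F n).
Proof.
rewrite /csumX /csum (big_morph wave_state (fun c d => esym (wave_stateD c d)) wave_state0).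
by apply: eq_bigr => k _; rewrite wave_stateZ.
Qed.

(** The Riemann sums of the resolvent are those of [(lam - nu)^-1] applied as
    scalars, and these tend to [2 i pi] times a zero winding number. *)
Lemma wave_riesz (gam : R -> C) : charf l N z = 0 -> winding gam nu 0 ->
  riesz_projection N l gam (wave_state 1) (wave_state 0).
Proof.
move=> f0 [gnu cvg]; split; first exact: wave_inX.
exists (fun lam => wave_state (lam - nu)^-1); split.
  move=> t t01; split; first exact: wave_inY.
  rewrite wave_stateZ Ac_wave_state wave_stateB -mulrBl mulfV; last by rewrite subr_eq0 gnu.
  exact: eqX_wave.
have [K KE] := normX2_wave.
under eq_fun do rewrite csumX_wave wave_stateZ wave_stateB KE subr0 normc2M.
apply: cvg_EFin; first by near=> n.
rewrite /= -[0](mul0r K); apply: cvgM; last exact: cvg_cst.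
rewrite -[0](mulr0 (normc2 (two_pi_i R)^-1)); apply: cvgM; first exact: cvg_cst.
move: cvg; under eq_fun do rewrite mulr0z mulr0 subr0.
by [].
Unshelve. all: by end_near. Qed.

Lemma wave_inH (gam : R -> C) : charf l N z = 0 -> winding gam nu 0 ->
  inH N l gam (wave_state 1).
Proof.
move=> f0 wind; split; first exact: wave_inX.
exists (wave_state 1), (wave_state 0); split; [exact: wave_inX|exact: wave_riesz|].
by rewrite wave_stateB; apply: eqX_wave; rewrite subr0.
Qed.

Lemma nu_neq0 : nu != 0.
Proof. by rewrite eq_complex /= eqxx /= expf_eq0 /= gt_eqF. Qed.

(** Once [nu] is known to be an eigenvalue on the full domain, the contour cannot
    wind around it, and this puts the eigenvector [wave_state 1] into the range of
    the complementary projection. *)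
Lemma Ac_eigenvalue_charf (gam : R -> C) : encloses_only_zero N l gam ->
  Ac_eigenvalue N l gam nu <-> charf l N z = 0.
Proof.
move=> [_ _ _ wind]; split=> [[y [[_ Yy] y0 Ay]]|f0].
  by apply: eigenvalue_charf; exists y.
have wn := wind nu nu_neq0 (charf_eigenvalue f0).
exists (wave_state 1); split; first by split; [exact: wave_inH|exact: wave_inY].
  exact: wave_neq0.
by rewrite Ac_wave_state wave_stateZ; exact: eqX_wave.
Qed.

End Eigenvectors.

Theorem proposition3p3 (R : realType) (N : nat) (l : nat -> R)
    (hN : (1 <= N)%N)
    (hl : forall j : nat, (1 <= j <= N.*2)%N -> 0 < l j) :
  exists g : R -> R,
    [/\ forall z : R, 0 < z ->
          charf l N z = (- z) ^+ N.-1 * (charf_infty l N z + g z),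
        g z @[z --> +oo] --> (0 : R) &
        forall gam : R -> R[i], encloses_only_zero N l gam ->
          [/\ forall z : R, 0 < z ->
                (Ac_eigenvalue N l gam (Complex 0 (z ^+ 2))
                   <-> charf l N z = 0),
              forall z : R, 0 < z ->
                (Ac_eigenvalue N l gam (Complex 0 (z ^+ 2))
                   <-> charf_infty l N z + g z = 0) &
              forall e : R, 0 < e -> \forall z \near +oo,
                Ac_eigenvalue N l gam (Complex 0 (z ^+ 2)) ->
                `|charf_infty l N z| < e]].
Proof.
pose g z := (- z) ^- N.-1 * charf l N z - charf_infty l N z.
have gE z : 0 < z -> charf l N z = (- z) ^+ N.-1 * (charf_infty l N z + g z).
  move=> z0; rewrite /g addrC subrK mulrA divff ?mul1r //.
  by rewrite expf_neq0 // oppr_eq0 gt_eqF.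
have g0 : g z @[z --> +oo] --> (0 : R).
  apply: charf_asymp => // j /andP[j1 jN]; apply: hl.
  by rewrite double_gt0 j1 leq_double.
have root z : 0 < z -> charf l N z = 0 <-> charf_infty l N z + g z = 0.
  move=> z0; rewrite gE //; split=> [/eqP|->]; last by rewrite mulr0.
  by rewrite mulf_eq0 expf_eq0 oppr_eq0 (gt_eqF z0) andbF => /eqP.
exists g; split=> // gam enc.
have eig z : 0 < z -> Ac_eigenvalue N l gam (Complex 0 (z ^+ 2)) <-> charf l N z = 0.
  by move=> z0; exact: Ac_eigenvalue_charf.
split=> // [z z0|e e0]; first exact: iff_trans (eig z z0) (root z z0).
near=> z; have z0 : 0 < z by near: z; exact: nbhs_pinfty_gt.
move=> /(eig z z0)/(root z z0)/eqP; rewrite addr_eq0 => /eqP ->; rewrite normrN.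
by near: z; exact: cvgr0_norm_lt.
Unshelve. all: by end_near. Qed.
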